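(* Let $\beta_0\in(1,\infty)$ be a non-integer and let $\lambda_{\beta_0}$ be a non-leading eigenvalue of $\mathcal{L}_{\beta_0}$ with multiplicity $M\ge 1$. Let $U_{\beta_0}\subset(1,\infty)$ be an open neighborhood of $\beta_0$, let $V_{\beta_0}\subset\mathbb{C}$ be an open neighborhood of $\lambda_{\beta_0}$, and let $\beta\in U_{\beta_0}\mapsto\lambda_\beta\in V_{\beta_0}$ be a function taking the value $\lambda_{\beta_0}$ at $\beta_0$, continuous at $\beta_0$, and such that $\lambda_\beta$ is a non-leading eigenvalue of $\mathcal{L}_\beta$ (equivalently, $\psi_\beta(\lambda_\beta^{-1})=0$ with $1<|\lambda_\beta^{-1}|<\beta$) for every $\beta\in U_{\beta_0}$. Then the following hold. (1) Assume that $\gamma_1:=\liminf_{n\to\infty}\sqrt[n]{\lim_{x\nearrow 1}\tau_{\beta_0}^n(x)}>0$ and set $$\alpha_1=\frac1M\left(\frac{\log|\beta_0\lambda_{\beta_0}|}{\log\beta_0+\log\gamma_1^{-1}}\right).$$ Then for any $\alpha<\alpha_1$ the function $\beta\mapsto\lambda_\beta$ is $\alpha$-Hölder continuous from the left at $\beta_0$. (2) Assume that $\gamma_2:=\liminf_{n\to\infty}\sqrt[n]{1-\tau_{\beta_0}^n(1)}>0$ and set $$\alpha_2=\frac1M\left(\frac{\log|\beta_0\lambda_{\beta_0}|}{\log\beta_0+\log\gamma_2^{-1}}\right).$$ Then for any $\alpha<\alpha_2$ the function $\beta\mapsto\lambda_\beta$ is $\alpha$-Hölder continuous from the right at $\beta_0$.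 (3) Let $$\alpha_0=\frac1M\left(\frac{\log|\beta_0\lambda_{\beta_0}|}{\log\beta_0}\right).$$ Then for any $\alpha>\alpha_0$ the function $\beta\mapsto\lambda_\beta$ is not $\alpha$-Hölder continuous at $\beta_0$. In particular, it is non-differentiable at $\beta_0$.
   Context: For real $\beta>1$, the beta-map is $\tau_\beta:[0,1]\to[0,1]$, $\tau_\beta(x)=\beta x-[\beta x]$, where $[y]$ is the integer part of $y\ge 0$; $\tau_\beta^0(x)=x$. Define $\psi_\beta(z)=1+\sum_{n=1}^\infty\frac{\tau_\beta^n(1)}{\beta^n}z^n$, analytic on $\{|z|<\beta\}$. Let $BV$ be the Banach space of functions $f:[0,1]\to\mathbb{C}$ of bounded variation with norm $\|f\|_{BV}=\operatorname{var}(f)+\sup_{x\in[0,1]}|f(x)|$, let $\mathcal{N}\subset BV$ be the closed subspace of those $f\in BV$ that vanish outside some countable set, and let $\widehat{BV}=BV/\mathcal{N}$ with the quotient norm. The Perron-Frobenius operator $\mathcal{L}_\beta f(x)=\frac1\beta\sum_{y\in[0,1],\,\tau_\beta(y)=x}f(y)$ is considered as a bounded operator on $\widehat{BV}$. Every spectral value $\lambda$ of $\mathcal{L}_\beta$ with $|\lambda|>1/\beta$ is an isolated eigenvalue of finite multiplicity and satisfies $|\lambda|\le1$; ''isolated eigenvalue'' means an eigenvalue with $|\lambda|>1/\beta$. The multiplicity of $\lambda$ is the algebraic one, i.e. the dimension of $\{f\in\widehat{BV}:\exists n\ge1,\ (\lambda I-\mathcal{L}_\beta)^nf=0\}$. The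 leading eigenvalue is $1$; a non-leading eigenvalue is an isolated eigenvalue different from $1$ (it then satisfies $1/\beta<|\lambda|<1$). A number $\lambda$ is a non-leading eigenvalue of $\mathcal{L}_\beta$ of multiplicity $M$ if and only if $1<|\lambda^{-1}|<\beta$ and $\lambda^{-1}$ is a zero of $\psi_\beta$ of multiplicity $M$. (Functions $\beta\mapsto\lambda_\beta$ as in the claim exist by Hurwitz's theorem; the claim concerns any one of them.) For an exponent $\alpha>0$, $\beta\mapsto\lambda_\beta$ is $\alpha$-Hölder continuous at $\beta_0$ if there are $C>0$ and $\delta>0$ with $|\lambda_\beta-\lambda_{\beta_0}|\le C|\beta-\beta_0|^\alpha$ for all $\beta\in U_{\beta_0}$ with $|\beta-\beta_0|<\delta$; it is $\alpha$-Hölder continuous from the left (respectively right) at $\beta_0$ if this holds for all such $\beta<\beta_0$ (respectively $\beta>\beta_0$). *)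

(* Defs.v *)
From HB Require Import structures.
From mathcomp Require Import all_boot all_order all_algebra.
From mathcomp Require Import all_classical all_reals all_analysis.
From mathcomp Require Import complex.

Set Implicit Arguments.
Unset Strict Implicit.
Unset Printing Implicit Defensive.

Import Order.TTheory GRing.Theory Num.Theory numFieldNormedType.Exports.
Import ComplexField.Normc.

Local Open Scope classical_set_scope.
Local Open Scope ring_scope.
Local Open Scope complex_scope.

(* R[i]^o is R[i] as a normed space over itself; its norm has values in R[i],
   so the R-valued modulus [normc] is used in inequalities.
   A function [0,1] -> C is represented by a total function on R. Its values
   outside [0,1] are never constrained, and two functions that agree on [0,1]
   differ by an element of [BVnull]. *)
Notation cfun R := (R -> R[i]^o).

(* Complex analogue of [variation 0 1 f s]. *)
Definition cvariation (R : realType) (f : cfun R) (s : seq R) : R :=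
  let F := f \o nth 1 (0 :: s) in
  \sum_(0 <= n < size s) normc (F n.+1 - F n).

Definition BV (R : realType) : set (cfun R) :=
  [set f | has_ubound [set cvariation f s | s in itv_partition 0 1]].

Definition BVnull (R : realType) : set (cfun R) :=
  [set f | BV f /\ countable [set x | x \in `[0, 1] /\ f x != 0]].

Definition tau (R : realType) (b x : R) : R :=
  b * x - (Num.floor (b * x))%:~R.

(* For b > 1 the set of preimages is finite, so the finitely supported sum is
   the full sum. *)
Definition PF (R : realType) (b : R) (f : cfun R) : cfun R :=
  fun x => (b^-1)%:C *
    \sum_(y \in [set y | y \in `[0, 1] /\ tau b y = x]) f y.

(* The space BV / BVnull is handled through representatives: vectors are
   elements of [BV], and a vector is zero when it lies in [BVnull]. *)
Definition PF_eigenvalue (R : realType) (b : R) (l : R[i]) : Prop :=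
  exists f : cfun R, [/\ BV f, ~ BVnull f & BVnull (PF b f - l *: f)].

Definition nonleading_eigenvalue (R : realType) (b : R) (l : R[i]) : Prop :=
  [/\ PF_eigenvalue b l, b^-1 < normc l & l != 1].

Definition gen_eigenspace (R : realType) (b : R) (l : R[i]) : set (cfun R) :=
  [set f | BV f /\ exists n : nat, (1 <= n)%N /\
     BVnull (iter n (fun g : cfun R => l *: g - PF b g) f)].

(* dim (E / N) = M, for a subspace N of E: there is a family of M vectors of E
   whose classes form a basis of E / N. *)
Definition quotient_dim (K : fieldType) (V : lmodType K) (E N : set V)
    (M : nat) : Prop :=
  exists e : 'I_M -> V,
    [/\ forall i, E (e i),
        forall c : 'I_M -> K, N (\sum_i c i *: e i) -> forall i, c i = 0
      & forall f, E f -> exists c : 'I_M -> K, N (f - \sum_i c i *: e i)].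

Definition eigenvalue_multiplicity (R : realType) (b : R) (l : R[i])
    (M : nat) : Prop :=
  quotient_dim (gen_eigenspace b l) (@BVnull R) M.

Definition gamma1 (R : realType) (b : R) : R :=
  limn_inf (fun n : nat =>
    (lim (iter n (tau b) x @[x --> (1 : R)^'-])) `^ (n%:R^-1)).

Definition gamma2 (R : realType) (b : R) : R :=
  limn_inf (fun n : nat => (1 - iter n (tau b) 1) `^ (n%:R^-1)).

(* Only points of D are compared with b0. *)
Definition holder_at (R : realType) (D : set R) (lam : cfun R) (b0 a : R) :
    Prop :=
  exists C d : R, [/\ 0 < C, 0 < d &
    forall b, D b -> `|b - b0| < d ->
      normc (lam b - lam b0) <= C * `|b - b0| `^ a].

(* Differentiability of a C-valued function of a real variable. *)
Definition cdifferentiable_at (R : realType) (lam : cfun R) (b0 : R) : Prop :=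
  cvg ((fun h : R => (lam (b0 + h) - lam b0) / h%:C : R[i]^o) @ (0 : R)^').

(* Main.v *)
Require Import Defs.
From HB Require Import structures.
From mathcomp Require Import all_boot all_order all_algebra.
From mathcomp Require Import all_classical all_reals all_analysis.
From mathcomp Require Import complex.
From mathcomp Require Import ring lra.

Import Order.TTheory GRing.Theory Num.Theory numFieldNormedType.Exports.
Import ComplexField.Normc.

Local Open Scope classical_set_scope.
Local Open Scope ring_scope.
Local Open Scope complex_scope.

Set Implicit Arguments.
Unset Strict Implicit.
Unset Printing Implicit Defensive.

(** Write T_n for the orbit of 1 under tau_b, d_n = floor (b T_n) for its digits
    and P_b(w) = 1 - sum_n d_n w^(n+1). This kneading series has bounded
    coefficients and equals (1 - b w) psi_b(b w); put w = 1/(b l).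

    Spectral part. PF sends 1_[0, T_n) to (d_n 1_[0, 1) + 1_[0, T_(n+1))) / b, so
    F(w) = sum_n w^n 1_[0, T_n) satisfies (l - PF) F(w) = l P_b(w) 1_[0, 1). On
    functions that vanish at 1- the operator contracts the variation by 1/b
    ([resolvent_null]), hence for |l| > 1/b a function f for which (l - PF) f is
    constant on [0, 1) is determined by its left limit at 1, and is a multiple of
    F(w) ([pencil_step1]). So l is an eigenvalue only if P_b(w) = 0. Taking
    derivatives of F at w0 gives a Jordan chain whose length is the order of the
    zero w0 of P_b, and the same uniqueness shows that it spans the generalized
    eigenspace ([multiplicity_defect]). Consequently |P_b0(w)| is comparable to
    |w - w0|^M near w0 ([kneading_order]). Orders of zeros are handled by
    repeated division by w - w0, which preserves bounded coefficients.

    Upper estimates. If the digits of b and b0 first differ at time n, then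
    P_b0 - P_b is O(|w|^(n+1)), so that the zero w_b of P_b satisfies
    |w_b - w0|^M = O(|w_b|^(n+1)). On the other hand the orbits of 1 in the two
    bases separate at rate b^n, and for b > b0 the digit can change only when the
    gap is at least 1 - T_(n+1); hence |b - b0| is at least of order
    (1 - T_(n+1)) / b^(n+1) ([first_diff_right]). Comparing the two exponential
    rates gives alpha2. For b < b0 the same argument applies to the quasi-greedy
    expansion q_n = lim tau^n(x), x increasing to 1, ([first_diff_left]); its
    kneading series differs from P_b0 by a factor that is bounded and, near w0,
    bounded away from 0 ([kneading_qkneading]). Both cases are [holder_of_digits].

    Lower estimate. For infinitely many n there are two bases below b0, within
    b0^(-n), whose digits follow the quasi-greedy digits of b0 up to time n and
    then stop, one immediately and one after a single further digit 1
    ([finite_expansions]). If the eigenvalue were Holder continuous with exponent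
    a > alpha0, then P_b0(w_b) would be O(b0^(-a M n)) = o(|w0|^n) for both, so that
    both normalized digit tails relative to b0 would be small at w0; but these
    tails differ by 1 there ([not_holder_le1]). As |l| < 1 for l <> 1
    ([eigenvalue_lt1]), alpha0 < 1, which excludes differentiability. *)

(** * Modulus and absolutely convergent series of complex numbers *)

Section ComplexModulus.
Variable R : rcfType.
Implicit Types x y z : R[i].

Lemma normc_ge0 z : 0 <= normc z.
Proof. by case: z => a b; exact: sqrtr_ge0. Qed.

Lemma normcD_le x y : normc (x + y) <= normc x + normc y.
Proof. exact: le_normcD. Qed.

Lemma normc_opp x : normc (- x) = normc x.
Proof. exact: normcN. Qed.

Lemma normc_distC x y : normc (x - y) = normc (y - x).
Proof. by rewrite -normc_opp opprB. Qed.

Lemma normcB_le x y : normc (x - y) <= normc x + normc y.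
Proof. by rewrite -(normc_opp y); exact: normcD_le. Qed.

Lemma normc_triangle y x z : normc (x - z) <= normc (x - y) + normc (y - z).
Proof. by rewrite -[x in x - z](subrK y) -addrA; exact: normcD_le. Qed.

Lemma normc_rtriangle x y : normc x <= normc y + normc (x - y).
Proof. by rewrite -{1}(subrKC y x); exact: normcD_le. Qed.

Lemma normcX x n : normc (x ^+ n) = normc x ^+ n.
Proof.
by elim: n => [|n IH]; rewrite ?expr0 ?normc1 // !exprS normcM IH.
Qed.

Lemma normc_eq0 x : (normc x == 0) = (x == 0).
Proof.
by apply/eqP/eqP => [/eq0_normc //|->]; exact: normc0.
Qed.

Lemma normc_gt0 x : (0 < normc x) = (x != 0).
Proof. by rewrite lt0r normc_eq0 normc_ge0 andbT. Qed.

Lemma normc_sum (I : Type) (r : seq I) (P : pred I) (F : I -> R[i]) :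
  normc (\sum_(i <- r | P i) F i) <= \sum_(i <- r | P i) normc (F i).
Proof.
elim/big_rec2: _ => [|i y x _ h]; first by rewrite normc0.
exact: le_trans (normcD_le _ _) (lerD (lexx _) h).
Qed.

Lemma normc_real (x : R) : normc x%:C = `|x|.
Proof. by rewrite /normc /= expr0n addr0 sqrtr_sqr. Qed.

Lemma Re_le_normc z : `|complex.Re z| <= normc z.
Proof.
case: z => a b /=; rewrite -sqrtr_sqr; apply: ler_wsqrtr.
by rewrite lerDl sqr_ge0.
Qed.

Lemma Im_le_normc z : `|complex.Im z| <= normc z.
Proof.
case: z => a b /=; rewrite -sqrtr_sqr; apply: ler_wsqrtr.
by rewrite lerDr sqr_ge0.
Qed.

Lemma normc_le_ReIm z : normc z <= `|complex.Re z| + `|complex.Im z|.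
Proof.
case: z => a b /=.
rewrite -[leRHS]ger0_norm ?addr_ge0 // -(sqrtr_sqr (_ + _)).
apply: ler_wsqrtr; rewrite sqrrD !real_normK ?num_real //.
by rewrite addrAC lerDl mulrn_wge0 // mulr_ge0.
Qed.

End ComplexModulus.

Section ComplexSums.
Variable R : realType.
Implicit Types (a c : nat -> R[i]) (s t z w : R[i]).

Definition is_csum a s :=
  forall e : R, 0 < e -> exists N, forall n, (N <= n)%N ->
    normc (\sum_(i < n) a i - s) < e.

Definition l1_le a (A : R) := forall n, \sum_(i < n) normc (a i) <= A.

Definition csum a : R[i] := xget 0 [set s | is_csum a s].

Lemma normc_small_eq s t : (forall e, 0 < e -> normc (s - t) <= e) -> s = t.
Proof.
move=> h; apply/eqP; rewrite -subr_eq0 -normc_eq0 eq_le normc_ge0 andbT.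
by apply/ler_addgt0Pr => e e0; rewrite add0r h.
Qed.

Lemma is_csum_unique a s t : is_csum a s -> is_csum a t -> s = t.
Proof.
move=> hs ht; apply: normc_small_eq => e e0.
have e2 : 0 < e / 2 by rewrite divr_gt0.
have [N hN] := hs _ e2; have [K hK] := ht _ e2.
have h1 := hN _ (leq_maxl N K); have h2 := hK _ (leq_maxr N K).
rewrite (le_trans (normc_triangle (\sum_(i < maxn N K) a i) _ _)) //.
by rewrite normc_distC; lra.
Qed.

Lemma csumE a s : is_csum a s -> csum a = s.
Proof.
move=> h; apply: (@is_csum_unique a) => //.
exact: (@xgetPex _ 0 [set s | is_csum a s] (ex_intro _ s h)).
Qed.

Lemma is_csum_ext a c s : a =1 c -> is_csum a s -> is_csum c s.
Proof.
move=> ac h e /h[N hN]; exists N => n /hN.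
by congr (normc (_ - _) < _); apply: eq_bigr => i _.
Qed.

Lemma is_csumD a c s t : is_csum a s -> is_csum c t ->
  is_csum (fun n => a n + c n) (s + t).
Proof.
move=> hs ht e e0; have e2 : 0 < e / 2 by rewrite divr_gt0.
have [N hN] := hs _ e2; have [K hK] := ht _ e2.
exists (maxn N K) => n; rewrite geq_max => /andP[/hN h1 /hK h2].
rewrite big_split opprD addrACA.
by have := normcD_le (\sum_(i < n) a i - s) (\sum_(i < n) c i - t); lra.
Qed.

Lemma is_csumZ z a s : is_csum a s -> is_csum (fun n => z * a n) (z * s).
Proof.
move=> h e e0; have z1 : 0 < normc z + 1 by rewrite ltr_wpDl ?normc_ge0.
have [N hN] := h _ (divr_gt0 e0 z1); exists N => n /hN hn.
rewrite -mulr_sumr -mulrBr normcM.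
have := normc_ge0 z; move: hn; rewrite ltr_pdivlMr // => hn z0.
apply: le_lt_trans hn; rewrite mulrC ler_wpM2l ?normc_ge0 // lerDl.
exact: ler01.
Qed.

Lemma is_csumB a c s t : is_csum a s -> is_csum c t ->
  is_csum (fun n => a n - c n) (s - t).
Proof.
move=> hs /(is_csumZ (-1)) ht; rewrite -[- t]mulN1r.
by apply: is_csum_ext (is_csumD hs ht) => n; rewrite mulN1r.
Qed.

Lemma is_csum_cons a s : is_csum (fun n => a n.+1) s -> is_csum a (a 0%N + s).
Proof.
move=> h e /h[N hN]; exists N.+1 => -[//|n] /hN.
by rewrite big_ord_recl opprD addrACA subrr add0r.
Qed.

Lemma is_csum_behead a s : is_csum a s -> is_csum (fun n => a n.+1) (s - a 0%N).
Proof.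
move=> h e /h[N hN]; exists N => n Nn.
have E z : z - (s - a 0%N) = a 0%N + z - s by ring.
by rewrite E; have := hN n.+1 (leqW Nn); rewrite big_ord_recl.
Qed.

Lemma is_csum_finite a N : (forall n, (N <= n)%N -> a n = 0) ->
  is_csum a (\sum_(i < N) a i).
Proof.
move=> h e e0; exists N => n Nn.
rewrite -(subnKC Nn) big_split_ord /= [X in _ + X - _]big1 => [|i _].
  by rewrite addr0 subrr normc0.
by apply: h; rewrite leq_addr.
Qed.

Lemma is_csum_le a s A : (forall n, normc (\sum_(i < n) a i) <= A) ->
  is_csum a s -> normc s <= A.
Proof.
move=> hA h; apply/ler_addgt0Pr => e /h[N /(_ _ (leqnn _)) hN].
have := normc_rtriangle s (\sum_(i < N) a i).
by rewrite normc_distC; have := hA N; lra.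
Qed.

Lemma is_csum_l1 a s A : l1_le a A -> is_csum a s -> normc s <= A.
Proof.
by move=> h; apply: is_csum_le => n; apply: le_trans (h n); exact: normc_sum.
Qed.

(** Complex convergence reduces to this case by real and imaginary parts. *)
Lemma real_series_cvg (u : nat -> R) A :
  (forall n, \sum_(i < n) `|u i| <= A) ->
  exists l : R, forall e, 0 < e -> exists N, forall n, (N <= n)%N ->
    `|\sum_(i < n) u i - l| < e.
Proof.
move=> h; have : cvgn (series u).
  apply: normed_cvg.
  suff : cvgn (series (fun n => `|u n|)) by [].
  apply: nondecreasing_is_cvgn.
    by apply/nondecreasing_seqP => n; rewrite /series /= !big_mkord big_ord_recr lerDl.
  by exists A => _ [n _ <-]; rewrite /series /= big_mkord; exact: h.
move=> cv; exists (limn (series u)) => e e0.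
have /cvgrPdist_lt /(_ _ e0)[N _ hN] := cv.
exists N => n /hN; by rewrite seriesEord distrC.
Qed.

Lemma l1_is_csum_ex a A : l1_le a A -> exists s, is_csum a s.
Proof.
move=> h.
have [x hx] : exists l : R, forall e, 0 < e -> exists N, forall n, (N <= n)%N ->
    `|\sum_(i < n) complex.Re (a i) - l| < e.
  apply: (@real_series_cvg (fun n => complex.Re (a n)) A) => n; apply: le_trans (h n).
  by apply: ler_sum => i _; exact: Re_le_normc.
have [y hy] : exists l : R, forall e, 0 < e -> exists N, forall n, (N <= n)%N ->
    `|\sum_(i < n) complex.Im (a i) - l| < e.
  apply: (@real_series_cvg (fun n => complex.Im (a n)) A) => n; apply: le_trans (h n).
  by apply: ler_sum => i _; exact: Im_le_normc.
exists (x +i* y) => e e0; have e2 : 0 < e / 2 by rewrite divr_gt0.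
have [N hN] := hx _ e2; have [K hK] := hy _ e2.
exists (maxn N K) => n; rewrite geq_max => /andP[/hN h1 /hK h2].
apply: le_lt_trans (normc_le_ReIm _) _.
rewrite !raddfB /= !raddf_sum /=; lra.
Qed.

Lemma csumP a A : l1_le a A -> is_csum a (csum a).
Proof. by move=> /l1_is_csum_ex[s h]; rewrite (csumE h). Qed.

Lemma l1_leM a c A B : l1_le a A -> (forall n, normc (c n) <= B) ->
  l1_le (fun n => a n * c n) (A * B).
Proof.
move=> hA hB n; have B0 : 0 <= B by apply: le_trans (hB 0%N); exact: normc_ge0.
apply: (@le_trans _ _ (\sum_(i < n) normc (a i) * B)).
  by apply: ler_sum => i _; rewrite normcM ler_wpM2l ?normc_ge0.
by rewrite -mulr_suml ler_wpM2r.
Qed.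

Lemma l1_geometric w : normc w < 1 ->
  l1_le (fun n => w ^+ n) (1 - normc w)^-1.
Proof.
move=> w1 n; have w0 : 0 < 1 - normc w by rewrite subr_gt0.
rewrite -[_^-1]mul1r ler_pdivlMr // mulrC.
under eq_bigr do rewrite normcX.
rewrite -[1 - normc w]opprB mulNr -subrX1 opprB lerBlDr lerDl.
by rewrite exprn_ge0 ?normc_ge0.
Qed.

End ComplexSums.

(** * Power series with bounded coefficients *)

Section PowerSeries.
Variable R : realType.
Implicit Types (a c : nat -> R[i]) (s t z w : R[i]) (A B : R).

Definition linf_le c B := forall n, normc (c n) <= B.

Definition pairing a c := csum (fun n => a n * c n).

Definition powers w : nat -> R[i] := fun n => w ^+ n.

Definition ps c w := pairing (powers w) c.

Lemma linf_le_ge0 c B : linf_le c B -> 0 <= B.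
Proof. by move=> /(_ 0%N); apply: le_trans; exact: normc_ge0. Qed.

Lemma linf_le_drop c B k : linf_le c B -> linf_le (fun i => c (k + i)%N) B.
Proof. by move=> h n; exact: h. Qed.

Lemma pairingP a c A B : l1_le a A -> linf_le c B ->
  is_csum (fun n => a n * c n) (pairing a c).
Proof. by move=> hA hB; apply: csumP (l1_leM hA hB). Qed.

Lemma pairing_le a c A B : l1_le a A -> linf_le c B ->
  normc (pairing a c) <= A * B.
Proof. by move=> hA hB; apply: is_csum_l1 (l1_leM hA hB) (pairingP hA hB). Qed.

Lemma psP c B w : linf_le c B -> normc w < 1 ->
  is_csum (fun n => w ^+ n * c n) (ps c w).
Proof. by move=> hB /l1_geometric hw; exact: pairingP hw hB. Qed.

Lemma ps_le c B w : linf_le c B -> normc w < 1 ->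
  normc (ps c w) <= (1 - normc w)^-1 * B.
Proof. by move=> hB /l1_geometric hw; exact: pairing_le hw hB. Qed.

Lemma ps_unique c w s : is_csum (fun n => w ^+ n * c n) s -> ps c w = s.
Proof. exact: csumE. Qed.

Lemma psB c1 c2 B1 B2 w : linf_le c1 B1 -> linf_le c2 B2 -> normc w < 1 ->
  ps (fun n => c1 n - c2 n) w = ps c1 w - ps c2 w.
Proof.
move=> h1 h2 w1; apply: ps_unique.
apply: is_csum_ext (is_csumB (psP h1 w1) (psP h2 w1)) => n /=.
by rewrite mulrBr.
Qed.

Lemma ps_cons c B w : linf_le c B -> normc w < 1 ->
  ps c w = c 0%N + w * ps (fun n => c n.+1) w.
Proof.
move=> hB w1; apply: ps_unique.
have := is_csumZ w (psP (linf_le_drop 1 hB) w1).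
rewrite -[c 0%N]mul1r -[1](expr0 w) => h.
apply: (is_csum_cons (a := fun n => w ^+ n * c n)).
by apply: is_csum_ext h => n; rewrite mulrA -exprS.
Qed.

Lemma ps_drop c B w k : linf_le c B -> normc w < 1 ->
  ps c w = \sum_(i < k) w ^+ i * c i + w ^+ k * ps (fun i => c (k + i)%N) w.
Proof.
move=> hB w1; elim: k => [|k IH].
  by rewrite big_ord0 add0r mul1r.
rewrite IH big_ord_recr /= -addrA; congr (_ + _).
rewrite (ps_cons (linf_le_drop k hB) w1) mulrDr addn0; congr (_ + _).
rewrite mulrA -exprSr; congr (_ * ps _ _); apply/funext => i.
by rewrite addSnnS.
Qed.

Lemma ps_finite c w k : (forall n, (k <= n)%N -> c n = 0) ->
  ps c w = \sum_(i < k) w ^+ i * c i.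
Proof.
move=> h; apply/ps_unique/(is_csum_finite (a := fun n => w ^+ n * c n)).
by move=> n /h ->; rewrite mulr0.
Qed.

(** Coefficients of the power series (w c(w) - w0 c(w0)) / (w - w0). Dividing
    by w - w0 in this way keeps the coefficients bounded, so the order of a
    zero can be read off by iteration, without any complex analysis. *)
Definition tails w0 c : nat -> R[i] := fun n => ps (fun i => c (n + i)%N) w0.

Lemma tails_le w0 c B : normc w0 < 1 -> linf_le c B ->
  linf_le (tails w0 c) ((1 - normc w0)^-1 * B).
Proof. by move=> w1 hB n; exact: ps_le (linf_le_drop n hB) w1. Qed.

Lemma tails0 w0 c : tails w0 c 0%N = ps c w0.
Proof. by []. Qed.

Lemma tailsS w0 c B n : normc w0 < 1 -> linf_le c B ->
  c n = tails w0 c n - w0 * tails w0 c n.+1.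
Proof.
move=> w1 hB; rewrite /tails (ps_cons (linf_le_drop n hB) w1) addn0.
rewrite (_ : (fun i => c (n + i.+1)%N) = (fun i => c (n.+1 + i)%N)) ?addrK //.
by apply/funext => i; rewrite addSnnS.
Qed.

Lemma ps_tails w0 w c B : normc w0 < 1 -> normc w < 1 -> linf_le c B ->
  w * ps c w = (w - w0) * ps (tails w0 c) w + w0 * ps c w0.
Proof.
move=> w01 w1 hB; have hT := tails_le w01 hB.
have -> : ps c w =
    ps (tails w0 c) w - w0 * ps (fun n => tails w0 c n.+1) w.
  apply: ps_unique.
  have h := is_csumZ w0 (psP (linf_le_drop 1 hT) w1).
  apply: is_csum_ext (is_csumB (psP hT w1) h) => n.
  by rewrite mulrCA -mulrBr -(tailsS _ w01 hB).
rewrite [ps (tails w0 c) w](ps_cons hT w1) tails0; ring.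
Qed.

(** The quotient by w - w0 in [ps_tails] is again a bounded power series,
    which gives the Lipschitz constant. *)
Lemma ps_lipschitz w0 w c B : normc w0 < 1 -> normc w < 1 -> linf_le c B ->
  normc (ps c w - ps c w0) <=
  normc (w - w0) * ((1 - normc w)^-1 * ((1 - normc w0)^-1 * B)).
Proof.
move=> w01 w1 hB; have hB1 := linf_le_drop 1 hB.
rewrite (ps_cons hB w1) (ps_cons hB w01).
rewrite (ps_tails w01 w1 hB1) (_ : _ - _ =
  (w - w0) * ps (tails w0 (fun n => c n.+1)) w); last by ring.
rewrite normcM ler_wpM2l ?normc_ge0 //.
exact: ps_le (tails_le w01 hB1) w1.
Qed.

(** [resolve w0 a] is (1 - w0 S)^-1 a for the right shift S. *)
Fixpoint resolve w0 a n : R[i] :=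
  if n is n'.+1 then a n + w0 * resolve w0 a n' else a 0%N.

Lemma resolve_l1 w0 a A : normc w0 < 1 -> l1_le a A ->
  l1_le (resolve w0 a) ((1 - normc w0)^-1 * A).
Proof.
move=> w1 hA n; have w0' : 0 < 1 - normc w0 by rewrite subr_gt0.
have A0 : 0 <= A by have := hA 0%N; rewrite big_ord0.
rewrite mulrC ler_pdivlMr // mulrBr mulr1 lerBlDr.
case: n => [|n]; first by rewrite big_ord0 mul0r addr0.
apply: le_trans (lerD (hA n.+1) (lexx _)).
rewrite [leLHS]big_ord_recl [X in _ <= X + _]big_ord_recl -addrA lerD2l.
apply: (@le_trans _ _ (\sum_(i < n) (normc (a i.+1) +
    normc w0 * normc (resolve w0 a i)))).
  apply: ler_sum => i _ /=; rewrite -normcM; exact: normcD_le.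
rewrite big_split /= lerD2l -mulr_sumr mulrC ler_wpM2r ?normc_ge0 //.
by rewrite big_ord_recr lerDl normc_ge0.
Qed.

(** [tails w0] is the transpose of [resolve w0], because the left shift is
    the transpose of the right shift. *)
Lemma pairing_resolve w0 a c A B : normc w0 < 1 -> l1_le a A ->
  linf_le c B -> pairing (resolve w0 a) c = pairing a (tails w0 c).
Proof.
move=> w1 hA hB; have hx := resolve_l1 w1 hA; have hT := tails_le w1 hB.
set x := resolve w0 a in hx *; set h := tails w0 c in hT *.
have hs := pairingP hx hT.
have ht := is_csumZ w0 (pairingP hx (linf_le_drop 1 hT)).
set s := pairing x h in hs; set t := w0 * _ in ht.
rewrite (_ : pairing x c = s - t); last first.
  apply: csumE; apply: is_csum_ext (is_csumB hs ht) => n.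
  by rewrite mulrCA -mulrBr (tailsS n w1 hB).
apply/esym/csumE.
have -> : s - t = a 0%N * h 0%N + (s - x 0%N * h 0%N - t).
  by rewrite -[a 0%N]/(x 0%N); ring.
apply: (is_csum_cons (a := fun n => a n * h n)).
apply: is_csum_ext (is_csumB (is_csum_behead hs) ht) => n.
by rewrite /x /=; ring.
Qed.

End PowerSeries.

(** * Complex functions of bounded variation *)

Section BoundedVariation.
Variable R : realType.
Implicit Types (f g : cfun R) (m : R -> R) (s t : seq R) (x y u v : R).

Fixpoint pvar f x s : R :=
  if s is y :: s' then normc (f y - f x) + pvar f y s' else 0.

Lemma pvar_ge0 f x s : 0 <= pvar f x s.
Proof. by elim: s x => //= y s IH x; rewrite addr_ge0 ?normc_ge0. Qed.

Lemma pvar_cat f x s t : pvar f x (s ++ t) = pvar f x s + pvar f (last x s) t.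
Proof. by elim: s x => [|y s IH] x /=; rewrite ?add0r // IH addrA. Qed.

Lemma cvariation_pvar f s : cvariation f s = pvar f 0 s.
Proof.
rewrite /cvariation /=.
suff h x : \sum_(0 <= n < size s) normc (f (nth 1 s n) - f (nth 1 (x :: s) n)) =
  pvar f x s by exact: h.
elim: s x => [|y s IH] x /=; first by rewrite big_geq.
by rewrite big_nat_recl //= -IH.
Qed.

Definition nondecr m := forall x y, x <= y -> m x <= m y.

(** Bounded variation in the form in which it is closed under sums, cut-offs
    and monotone changes of variable: increments of f are bounded by those of
    a monotone function. *)
Definition dominates m f := nondecr m /\
  forall u v, 0 <= u -> u <= v -> v <= 1 -> normc (f v - f u) <= m v - m u.

Lemma lt_path_last x s : path <%O x s -> x <= last x s.
Proof.
by elim: s x => //= y s IH x /andP[xy /IH]; apply: le_trans (ltW xy).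
Qed.

Lemma dominates_pvar m f x s : dominates m f -> 0 <= x ->
  path <%O x s -> last x s <= 1 -> pvar f x s <= m (last x s) - m x.
Proof.
move=> [mn h]; elim: s x => [|y s IH] x x0 /=; first by rewrite subrr.
move=> /andP[xy p] l1; have y0 := le_trans x0 (ltW xy).
have yl : y <= last y s.
  exact: lt_path_last.
by have := IH _ y0 p l1; have := h _ _ x0 (ltW xy) (le_trans yl l1); lra.
Qed.

Lemma dominates_BV m f : dominates m f -> BV f.
Proof.
move=> h; exists (m 1 - m 0) => _ [s [p /eqP l1] <-].
rewrite cvariation_pvar; apply: le_trans (dominates_pvar h (lexx 0) p _) _.
  by rewrite l1.
by rewrite l1.
Qed.

(** The running total variation of f is the canonical dominating function. *)
Lemma BV_dominates f : BV f -> exists m, dominates m f.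
Proof.
move=> [A hA].
pose S x := [set pvar f 0 s | s in [set s | path <%O 0 s /\
  last 0 s <= Num.max 0 (Num.min x 1)]].
have Sne x : S x !=set0.
  by exists (pvar f 0 [::]), [::] => //=; split => //; rewrite le_max lexx.
have Sub x : has_ubound (S x).
  exists A => _ [s /= [p l1] <-].
  have {}l1 : last 0 s <= 1.
    by apply: le_trans l1 _; rewrite ge_max ler01 ge_min lexx orbT.
  case: (ltgtP (last 0 s) 1) l1 => // l1 _.
    apply: (@le_trans _ _ (pvar f 0 (rcons s 1))).
      by rewrite -cats1 pvar_cat lerDl pvar_ge0.
    apply: hA; exists (rcons s 1); last by rewrite cvariation_pvar.
    by split; rewrite ?rcons_path ?last_rcons ?p //= l1.
  apply: hA; exists s; last by rewrite cvariation_pvar.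
  by split; rewrite ?l1.
have in_sup x s : path <%O 0 s -> last 0 s <= Num.max 0 (Num.min x 1) ->
    pvar f 0 s <= sup (S x).
  by move=> p l; apply: ub_le_sup => //; exists s.
exists (fun x => sup (S x)); split=> [x y xy|u v u0 uv v1].
  apply: ge_sup => // _ [s /= [p l] <-]; apply: in_sup => //.
  apply: le_trans l _; rewrite ge_max !le_max lexx /=.
  by rewrite le_min !ge_min xy lexx !orbT.
have Eu : Num.max 0 (Num.min u 1) = u.
  by rewrite min_l ?max_r //; exact: le_trans uv v1.
have Ev : Num.max 0 (Num.min v 1) = v.
  by rewrite min_l ?max_r //; exact: le_trans u0 uv.
have [->|/eqP uv'] := eqVneq u v; first by rewrite !subrr normc0.
have {uv'} uv' : u < v by rewrite lt_neqAle uv andbT; apply/eqP.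
rewrite lerBrDr -lerBrDl.
apply: ge_sup => // _ [s /= [p l] <-]; rewrite Eu in l.
rewrite lerBrDl addrC.
move: l; rewrite le_eqVlt => /orP[/eqP l|l].
  apply: le_trans (in_sup v (rcons s v) _ _).
  - by rewrite -cats1 pvar_cat l /= addr0.
  - by rewrite rcons_path p l.
  - by rewrite last_rcons Ev.
apply: le_trans (in_sup v (s ++ [:: u; v]) _ _).
- by rewrite pvar_cat /= addr0 lerD2l lerDr normc_ge0.
- by rewrite cat_path p /= l uv'.
- by rewrite last_cat /= Ev.
Qed.

Lemma BVP f : BV f <-> exists m, dominates m f.
Proof. by split=> [/BV_dominates|[m /dominates_BV]]. Qed.

Lemma dominatesD m1 m2 f g : dominates m1 f -> dominates m2 g ->
  dominates (m1 \+ m2) (f + g).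
Proof.
move=> [n1 h1] [n2 h2]; split=> [x y xy|u v u0 uv v1] /=.
  by rewrite lerD ?n1 ?n2.
rewrite [X in normc X](_ : _ = (f v - f u) + (g v - g u)).
  by have := normcD_le (f v - f u) (g v - g u);
     have := h1 _ _ u0 uv v1; have := h2 _ _ u0 uv v1; lra.
by rewrite opprD addrACA.
Qed.

Lemma dominatesZ m f (c : R[i]) : dominates m f ->
  dominates (fun x => normc c * m x) (c *: f).
Proof.
move=> [n h]; split=> [x y xy|u v u0 uv v1].
  by rewrite ler_wpM2l ?normc_ge0 ?n.
rewrite [X in normc X](_ : _ = c * (f v - f u)); last by rewrite mulrBr.
by rewrite normcM -mulrBr ler_wpM2l ?normc_ge0 ?h.
Qed.

Lemma BV0 : BV (0 : cfun R).
Proof.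
by apply/BVP; exists (fun=> 0); split=> // u v _ _ _; rewrite !subrr normc0.
Qed.

Lemma BVD f g : BV f -> BV g -> BV (f + g).
Proof.
by move=> /BVP[m h] /BVP[m' h']; apply/BVP; exists (m \+ m'); exact: dominatesD.
Qed.

Lemma BVZ (c : R[i]) f : BV f -> BV (c *: f).
Proof. by move=> /BVP[m h]; apply/BVP; eexists; exact: dominatesZ h. Qed.

Lemma BVB f g : BV f -> BV g -> BV (f - g).
Proof. by move=> hf hg; rewrite -scaleN1r; apply: BVD => //; exact: BVZ. Qed.

Lemma BV_sum (I : Type) (r : seq I) (P : pred I) (F : I -> cfun R) :
  (forall i, P i -> BV (F i)) -> BV (\sum_(i <- r | P i) F i).
Proof. by move=> h; elim/big_rec: _ => [|i g Pi]; [exact: BV0|apply: BVD; exact: h]. Qed.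

(** ** Left limits at 1 *)

Definition left_lim1 f (c : R[i]) := forall e : R, 0 < e ->
  exists2 z : R, 0 <= z < 1 & forall x, z < x -> x < 1 -> normc (f x - c) < e.

Lemma left_lim1D f g (c d : R[i]) : left_lim1 f c -> left_lim1 g d ->
  left_lim1 (f + g) (c + d).
Proof.
move=> hf hg e e0; have e2 : 0 < e / 2 by rewrite divr_gt0.
have [z /andP[z0 z1] hz] := hf _ e2; have [y /andP[y0 y1] hy] := hg _ e2.
exists (Num.max z y) => [|x]; first by rewrite le_max z0 gt_max z1 y1.
rewrite gt_max => /andP[zx yx] x1; rewrite /= opprD addrACA.
have := normcD_le (f x - c) (g x - d).
by have := hz _ zx x1; have := hy _ yx x1; lra.
Qed.

Lemma left_lim1Z f (c d : R[i]) : left_lim1 f c -> left_lim1 (d *: f) (d * c).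
Proof.
move=> h e e0; have d1 : 0 < normc d + 1 by rewrite ltr_wpDl ?normc_ge0.
have [z z01 hz] := h _ (divr_gt0 e0 d1); exists z => // x zx x1.
have := hz _ zx x1; rewrite ltr_pdivlMr // => hx.
rewrite [X in normc X](_ : _ = d * (f x - c)); last by rewrite mulrBr.
rewrite normcM.
apply: le_lt_trans hx; rewrite mulrC ler_wpM2l ?normc_ge0 // lerDl.
exact: ler01.
Qed.

Lemma nondecr_left_lim m : nondecr m -> exists l : R, forall e, 0 < e ->
  exists2 z : R, 0 <= z < 1 & forall x, z < x -> x < 1 -> `|m x - l| < e.
Proof.
move=> mn; pose S := [set m x | x in [set x : R | 0 <= x < 1]].
have S0 : S (m 0) by exists 0 => //=; rewrite lexx ltr01.
have hS : has_sup S.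
  split; first by exists (m 0).
  by exists (m 1) => _ [x /= /andP[_ x1] <-]; apply: mn; exact: ltW.
exists (sup S) => e e0; have [_ [z z01 <-] hz] := sup_adherent e0 hS.
exists z => // x zx x1; have z0 : 0 <= z by case/andP: z01.
have : m x <= sup S.
  by apply: ub_le_sup; [case: hS|exists x; rewrite //= x1 (le_trans z0 (ltW zx))].
have := mn _ _ (ltW zx); rewrite ltr_distlC; lra.
Qed.

(** If m dominates f then m + Re f, m + Im f and m are monotone, hence have left
    limits at 1. *)
Lemma BV_left_lim1 f : BV f -> exists c, left_lim1 f c.
Proof.
move=> /BVP[m [mn h]].
(* Clamping to [0, 1] makes the monotonicity estimates global. *)
pose k (x : R) : R := Num.max 0 (Num.min x 1).
have k01 x : 0 <= k x <= 1.
  by rewrite le_max lexx ge_max ler01 ge_min lexx orbT.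
have kn x y : x <= y -> k x <= k y.
  move=> xy; rewrite ge_max !le_max lexx /=.
  by rewrite le_min !ge_min xy lexx !orbT.
have kE x : 0 <= x -> x <= 1 -> k x = x.
  by move=> x0 x1; rewrite /k min_l ?max_r.
have hk x y : x <= y -> normc (f (k y) - f (k x)) <= m (k y) - m (k x).
  move=> xy; have /andP[x0 _] := k01 x; have /andP[_ y1] := k01 y.
  exact: h x0 (kn _ _ xy) y1.
have real_part (p : R[i] -> R) : (forall z, `|p z| <= normc z) ->
    {morph p : z y / z - y} -> exists l : R, forall e, 0 < e ->
    exists2 z : R, 0 <= z < 1 & forall x, z < x -> x < 1 -> `|p (f x) - l| < e.
  move=> pn pB.
  have n1 : nondecr (fun x => m (k x) + p (f (k x))).
    move=> x y xy; have := hk _ _ xy; have := pn (f (k y) - f (k x)).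
    by rewrite pB ler_norml => /andP[]; lra.
  have n2 : nondecr (fun x => m (k x)) by move=> x y /kn /mn.
  have [l1 h1] := nondecr_left_lim n1; have [l2 h2] := nondecr_left_lim n2.
  exists (l1 - l2) => e e0; have e2 : 0 < e / 2 by rewrite divr_gt0.
  have [z /andP[z0 z1] hz] := h1 _ e2; have [y /andP[y0 y1] hy] := h2 _ e2.
  exists (Num.max z y) => [|x]; first by rewrite le_max z0 gt_max z1 y1.
  rewrite gt_max => /andP[zx yx] x1; have := hz _ zx x1; have := hy _ yx x1.
  rewrite kE ?(ltW x1) ?(le_trans z0 (ltW zx)) // !ltr_distlC; lra.
have [a ha] := real_part _ (@Re_le_normc R) (raddfB _).
have [b hb] := real_part _ (@Im_le_normc R) (raddfB _).
exists (a +i* b) => e e0; have e2 : 0 < e / 2 by rewrite divr_gt0.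
have [z /andP[z0 z1] hz] := ha _ e2; have [y /andP[y0 y1] hy] := hb _ e2.
exists (Num.max z y) => [|x]; first by rewrite le_max z0 gt_max z1 y1.
rewrite gt_max => /andP[zx yx] x1; have := hz _ zx x1; have := hy _ yx x1.
have := normc_le_ReIm (f x - (a +i* b)); rewrite !raddfB /=; lra.
Qed.

End BoundedVariation.

(** * The Perron-Frobenius operator on functions of bounded variation *)

Section Transfer.
Variable R : realType.
Implicit Types (f g : cfun R) (m : R -> R) (b x y u v : R).

(** Truncating to [0, 1] turns the sum over preimages into a sum over all
    branches. *)
Definition trunc1 f y : R[i] := if y <= 1 then f y else 0.

Definition branch b (k : nat) x : R := (x + k%:R) / b.

Lemma tau_itv b x : 0 <= tau b x < 1.
Proof.
rewrite /tau; have /andP[h1 h2] := floor_itv (b * x).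
by rewrite intrD in h2; rewrite subr_ge0 h1 /= ltrBlDl.
Qed.

Lemma floor_addn x (k : nat) : 0 <= x -> x < 1 -> Num.floor (x + k%:R) = k%:Z.
Proof.
move=> x0 x1; apply: floor_def; rewrite intrD -pmulrn lerDr x0 /=.
by rewrite addrC ltrD2l.
Qed.

Lemma tau_branch b k x : 0 < b -> 0 <= x -> x < 1 -> tau b (branch b k x) = x.
Proof.
move=> b0 x0 x1; rewrite /tau /branch mulrC divfK ?gt_eqF //.
by rewrite floor_addn // -pmulrn addrK.
Qed.

Lemma branch_preimage b y : 0 < b -> 0 <= y ->
  exists k : nat, y = branch b k (tau b y) /\ k%:R <= b * y.
Proof.
move=> b0 y0; have : 0 <= Num.floor (b * y) by rewrite floor_ge0 mulr_ge0 // ltW.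
have /andP[h _] := floor_itv (b * y).
case E : (Num.floor (b * y)) h => [k|//] h _; exists k; split; last first.
  by rewrite pmulrn.
by rewrite /branch /tau E -pmulrn subrK mulrAC divff ?gt_eqF // mul1r.
Qed.

Lemma branch_inj b x : 0 < b -> injective (branch b ^~ x).
Proof.
move=> b0 k k' /(congr1 ( *%R^~ b)); rewrite /branch !divfK ?gt_eqF //.
by move=> /addrI /eqP; rewrite eqr_nat => /eqP.
Qed.

Lemma branch_ge0 b k x : 0 < b -> 0 <= x -> 0 <= branch b k x.
Proof. by move=> b0 x0; rewrite divr_ge0 ?addr_ge0 // ltW. Qed.

Lemma branch_lt b k x y : 0 < b -> x < y -> branch b k x < branch b k y.
Proof. by move=> b0 xy; rewrite /branch ltr_pM2r ?invr_gt0 // ltrD2r. Qed.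

Lemma branch_le b k x y : 0 < b -> x <= y -> branch b k x <= branch b k y.
Proof. by move=> b0 xy; rewrite /branch ler_pM2r ?invr_gt0 // lerD2r. Qed.

Lemma branch_next b k x y : 0 < b -> x < 1 -> 0 <= y ->
  branch b k x < branch b k.+1 y.
Proof.
by move=> b0 x1 y0; rewrite /branch ltr_pM2r ?invr_gt0 // mulrS; lra.
Qed.

Lemma PF_E b f x : 1 < b -> 0 <= x -> x < 1 -> PF b f x =
  (b^-1)%:C * \sum_(k < Num.bound b) trunc1 f (branch b k x).
Proof.
move=> b1 x0 x1; have b0 : 0 < b by apply: lt_trans b1.
have bK : b < (Num.bound b)%:R by apply: archi_boundP; exact: ltW.
rewrite /PF; congr (_ * _).
pose r := [seq y <- [seq branch b k x | k <- iota 0 (Num.bound b)] | y <= 1].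
rewrite (@fsbigE _ _ _ _ _ r).
- rewrite -big_filter (_ : [seq i <- r | _] = r); last first.
    apply/all_filterP/allP => y; rewrite mem_filter => /andP[y1 /mapP[k _ E]].
    rewrite inE /= E; split; last exact: tau_branch.
    by rewrite in_itv /= branch_ge0 //= -E.
  rewrite -[RHS](big_mkord xpredT (fun k => trunc1 f (branch b k x))).
  by rewrite big_filter big_map big_mkcond /index_iota subn0.
- by rewrite filter_uniq // map_inj_uniq ?iota_uniq //; exact: branch_inj.
- move=> y /=; rewrite mem_filter => /andP[y1 /mapP[k _ E]].
  split; last by rewrite E tau_branch.
  by rewrite in_itv /= y1 andbT E branch_ge0.
- move=> y /= [y01 ty] /negP[]; move: y01; rewrite in_itv /= => /andP[y0 y1].
  rewrite mem_filter y1; apply/mapP.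
  have [k [E kb]] := branch_preimage b0 y0; exists k; last by rewrite -ty.
  rewrite mem_iota add0n -(ltr_nat R); apply: le_lt_trans bK.
  by apply: le_trans kb _; rewrite ger_pMr.
Qed.

Lemma PF_out b f x : ~~ (0 <= x < 1) -> PF b f x = 0.
Proof.
move=> xN; rewrite /PF fsbig1 ?mulr0 // => y [_ E].
by move: xN; rewrite -E tau_itv.
Qed.

Lemma PFD b f g : 1 < b -> PF b (f + g) = PF b f + PF b g.
Proof.
move=> b1; apply/funext => x; rewrite -[RHS]/(PF b f x + PF b g x).
have [/andP[x0 x1]|xN] := boolP (0 <= x < 1); last by rewrite !PF_out // addr0.
rewrite !PF_E // -mulrDr -big_split; congr (_ * _); apply: eq_bigr => k _.
by rewrite /trunc1; case: ifP => _ //=; rewrite addr0.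
Qed.

Lemma PFZ b f (c : R[i]) : 1 < b -> PF b (c *: f) = c *: PF b f.
Proof.
move=> b1; apply/funext => x; rewrite -[RHS]/(c * PF b f x).
have [/andP[x0 x1]|xN] := boolP (0 <= x < 1); last first.
  by rewrite !PF_out // mulr0.
rewrite !PF_E //.
have -> : \sum_(k < Num.bound b) trunc1 (c *: f) (branch b k x) =
    c * \sum_(k < Num.bound b) trunc1 f (branch b k x) :> R[i].
  rewrite mulr_sumr; apply: eq_bigr => k _.
  by rewrite /trunc1; case: ifP => _ //; rewrite mulr0.
by rewrite mulrCA.
Qed.

Lemma dominates_cut m f : dominates m f ->
  dominates (fun x => if x < 1 then m x else m 1 + normc (f 1))
    (fun x => if x < 1 then f x else 0).
Proof.
move=> [mn h]; split=> [x y xy|u v u0 uv v1].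
  case: (ltP x 1) (ltP y 1) => [x1|x1] [y1|y1]; rewrite ?mn //.
    by apply: ler_wpDr; [exact: normc_ge0|apply: mn; exact: ltW].
  by have := le_lt_trans (le_trans x1 xy) y1; rewrite ltxx.
case: (ltP u 1) (ltP v 1) => [u1|u1] [v1'|v1']; rewrite ?h ?subrr ?normc0 //.
  rewrite sub0r normc_opp.
  have := h _ _ u0 (ltW u1) (lexx 1); have := normc_rtriangle (f u) (f 1).
  by rewrite (normc_distC (f u)); lra.
by have := le_lt_trans (le_trans u1 uv) v1'; rewrite ltxx.
Qed.

Lemma dominates_trunc1 m f : dominates m f ->
  nondecr (fun y => if y <= 1 then m y else m 1 + normc (f 1)) /\
  forall u v, 0 <= u -> u <= v ->
   normc (trunc1 f v - trunc1 f u) <=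
   (if v <= 1 then m v else m 1 + normc (f 1)) -
   (if u <= 1 then m u else m 1 + normc (f 1)).
Proof.
move=> [mn h]; split=> [x y xy|u v u0 uv].
  case: (leP x 1) (leP y 1) => [x1|x1] [y1|y1]; rewrite ?mn //.
    by apply: ler_wpDr; [exact: normc_ge0|exact: mn].
  by have := lt_le_trans (lt_le_trans x1 xy) y1; rewrite ltxx.
rewrite /trunc1.
case: (leP u 1) (leP v 1) => [u1|u1] [v1'|v1']; rewrite ?h ?subrr ?normc0 //.
  rewrite sub0r normc_opp.
  have := h _ _ u0 u1 (lexx 1); have := normc_rtriangle (f u) (f 1).
  by rewrite (normc_distC (f u)); lra.
by have := lt_le_trans (lt_le_trans u1 uv) v1'; rewrite ltxx.
Qed.

(** On [0, 1) the operator is a finite sum of f composed with the increasing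
    branches, cut off where a branch leaves [0, 1]. *)
Lemma BV_PF b f : 1 < b -> BV f -> BV (PF b f).
Proof.
move=> b1 /BVP[m hm]; have b0 : 0 < b by apply: lt_trans b1.
pose F : cfun R := (b^-1)%:C *:
  \sum_(k < Num.bound b) (fun x => trunc1 f (branch b k x) : R[i]^o).
have : BV F.
  apply/BVZ/BV_sum => k _; have [n h] := dominates_trunc1 hm.
  apply/BVP; exists (fun x => if branch b k x <= 1 then m (branch b k x)
    else m 1 + normc (f 1)); split=> [x y xy|u v u0 uv _].
    by apply: (n (branch b k x) (branch b k y)); exact: branch_le.
  by apply: h; [exact: branch_ge0|exact: branch_le].
move=> /BVP[M hM]; have := dominates_cut hM.
set M' := (fun x : R => if _ then _ else _) => hM'.
apply/BVP; exists M'; case: hM' => n h; split=> // u v u0 uv v1.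
suff E x : 0 <= x -> PF b f x = if x < 1 then F x else 0.
  by rewrite !E ?h // (le_trans u0 uv).
move=> x0; case: (ltP x 1) => x1; last by rewrite PF_out // x0 ltNge x1.
by rewrite PF_E // /F /= fct_sumE.
Qed.

(** ** Equality off a countable set *)

Definition null_off f := countable [set x | x \in `[0, 1] /\ f x != 0].

Lemma subset_countable (T : Type) (A B : set T) :
  A `<=` B -> countable B -> countable A.
Proof. by move=> /subset_card_le; exact: sub_countable. Qed.

Lemma countableU (T : Type) (A B : set T) :
  countable A -> countable B -> countable (A `|` B).
Proof.
move=> cA cB; rewrite -bigcup2E; apply: bigcup_countable => // -[|[|i]] _ //.
Qed.

Lemma null_offD f g : null_off f -> null_off g -> null_off (f + g).
Proof.
move=> hf hg; apply: subset_countable (countableU hf hg) => x /= [x01 h].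
have [f0|fN] := eqVneq (f x) 0; last by left.
right; split=> //; have <- // : (f + g) x = g x.
by rewrite -[LHS]/(f x + g x) f0 add0r.
Qed.

Lemma null_offZ f (c : R[i]) : null_off f -> null_off (c *: f).
Proof.
apply: subset_countable => x /= [x01 h]; split=> //.
by apply: contraNneq h => f0; rewrite -[_ x]/(c * f x) f0 mulr0.
Qed.

Lemma null_off_PF b f : 1 < b -> null_off f -> null_off (PF b f).
Proof.
move=> b1 h; have b0 : 0 < b by apply: lt_trans b1.
apply: (@subset_countable _ _ (tau b @` [set x | x \in `[0, 1] /\ f x != 0])).
  move=> x /= [_]; have [/andP[x0 x1]|xN] := boolP (0 <= x < 1); last first.
    by rewrite PF_out // eqxx.
  rewrite PF_E // mulf_eq0 => /norP[_ hs].
  have [k hk] : exists k : 'I_(Num.bound b), trunc1 f (branch b k x) != 0.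
    apply/existsP; rewrite -negb_forall; apply: contra hs => /forallP h0.
    by rewrite big1 // => k _; apply/eqP.
  exists (branch b k x); last exact: tau_branch.
  move: hk; rewrite /trunc1; case: ifP => [l1 fN|_]; last by rewrite eqxx.
  by rewrite in_itv /= l1 branch_ge0.
exact: sub_countable (card_image_le _ _) h.
Qed.

Lemma BVnull0 : BVnull (0 : cfun R).
Proof.
split; first exact: BV0.
by rewrite (_ : [set x | _] = set0) // -subset0 => x /= []; rewrite eqxx.
Qed.

Lemma BVnullD f g : BVnull f -> BVnull g -> BVnull (f + g).
Proof. by move=> [f1 f2] [g1 g2]; split; [exact: BVD|exact: null_offD]. Qed.

Lemma BVnullZ (c : R[i]) f : BVnull f -> BVnull (c *: f).
Proof. by move=> [f1 f2]; split; [exact: BVZ|exact: null_offZ]. Qed.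

Lemma BVnull_PF b f : 1 < b -> BVnull f -> BVnull (PF b f).
Proof. by move=> b1 [f1 f2]; split; [exact: BV_PF|exact: null_off_PF]. Qed.

(** A non-degenerate interval has positive Lebesgue measure, so exceptional
    countable sets can always be avoided. *)
Lemma countable_dense (C : set R) u v : countable C -> u < v ->
  exists x, [/\ u < x, x < v & ~ C x].
Proof.
move=> cC uv; apply: contrapT => h.
have sub : `]u, v[%classic `<=` C.
  move=> x /=; rewrite in_itv /= => /andP[ux xv]; apply: contrapT => Cx.
  by apply: h; exists x.
have := countable_lebesgue_measure0 (subset_countable sub cC).
rewrite lebesgue_measure_itv /= lte_fin uv => /eqP.
by rewrite -EFinB eqe subr_eq0 gt_eqF.
Qed.

(** Left limits at 1 do not see null functions. *)
Lemma left_lim1_null f (c : R[i]) : null_off f -> left_lim1 f c -> c = 0.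
Proof.
move=> hN hl; apply: normc_small_eq => e e0; have [z /andP[z0 z1] hz] := hl _ e0.
have [x [zx x1 Cx]] := countable_dense hN z1.
suff E : f x = 0 by have := hz _ zx x1; rewrite E normc_distC => /ltW.
apply/eqP/negPn/negP => fN; apply: Cx; split=> //.
by rewrite in_itv /= (ltW x1) (le_trans z0 (ltW zx)).
Qed.

End Transfer.

(** * Contraction of the variation *)

Section Contraction.
Variable R : realType.
Implicit Types (f g : cfun R) (m : R -> R) (b x y u v : R) (s : seq R).

(** A point outside the forward orbit of an exceptional set has no exceptional
    preimage, so identities valid off C can be iterated off C. *)
Lemma forward_closure (C0 : set R) b : countable C0 ->
  exists C : set R, [/\ countable C, C0 `<=` C &
    forall y, C y -> C (tau b y)].
Proof.
move=> c0; exists (\bigcup_n (iter n (tau b) @` C0)); split.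
- apply: bigcup_countable => // n _.
  exact: sub_countable (card_image_le _ _) c0.
- by move=> x Cx; exists 0%N => //; exists x.
- by move=> _ [n _ [x Cx <-]]; exists n.+1 => //; exists x.
Qed.

Section PVar.
Variables (b : R) (G : cfun R).
Hypothesis b0 : 0 < b.

(** Concatenating the images of a list under successive branches keeps it
    increasing, so the variations contributed by the different branches add up
    to at most one total variation; see [branchesP]. *)
Fixpoint branches (z : R) s n : seq R :=
  if n is n'.+1 then
    branches z s n' ++ branch b n z :: [seq branch b n x | x <- s]
  else [seq branch b 0 x | x <- s].

Lemma path_branch k z s : path <%O z s ->
  path <%O (branch b k z) [seq branch b k x | x <- s].
Proof.
by elim: s z => //= y s IH z /andP[zy /IH ->]; rewrite branch_lt.
Qed.

Lemma branchesP z s n : path <%O z s -> 0 <= z -> last z s < 1 ->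
  [/\ path <%O (branch b 0 z) (branches z s n),
      last (branch b 0 z) (branches z s n) = branch b n (last z s),
      forall y, y \in branch b 0 z :: branches z s n ->
        exists k x, x \in z :: s /\ y = branch b k x
    & \sum_(k < n.+1) pvar G (branch b k z) [seq branch b k x | x <- s] <=
      pvar G (branch b 0 z) (branches z s n)].
Proof.
move=> p z0 l1; elim: n => [|n [IH1 IH2 IH3 IH4]].
  split=> /=; [exact: path_branch|by rewrite last_map| |by rewrite big_ord1].
  move=> y; rewrite inE => /orP[/eqP->|/mapP[x xs ->]].
    by exists 0%N, z; rewrite mem_head.
  by exists 0%N, x; rewrite inE xs orbT.
split=> /=.
- rewrite cat_path IH1 IH2 /= path_branch // andbT.
  exact: branch_next.
- by rewrite last_cat /= last_map.
- move=> y; rewrite inE mem_cat orbA => /orP[/IH3 //|].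
  rewrite inE => /orP[/eqP->|/mapP[x xs ->]].
    by exists n.+1, z; rewrite mem_head.
  by exists n.+1, x; rewrite inE xs orbT.
- rewrite big_ord_recr /= pvar_cat /= lerD //.
  by rewrite lerDr normc_ge0.
Qed.

End PVar.

(** On functions that vanish at 1-, each branch contributes its own piece of
    the variation scaled by 1/b, and cutting off at 1 creates no jump; so PF
    contracts the variation by 1/b. Since l g - PF g is constant on [0, 1) up
    to a countable set and |l| > 1/b, the variation of g must vanish. All
    variations are taken along lists that avoid the countable set C. *)
Lemma resolvent_null b (l a : R[i]) g : 1 < b -> b^-1 < normc l ->
  BV g -> left_lim1 g 0 ->
  null_off (l *: g - PF b g - (fun x => if 0 <= x < 1 then a else 0)) ->
  null_off g.
Proof.
move=> b1 bl hBV hlim hnull; have b0 : 0 < b by apply: lt_trans b1.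
have [C [cC subC forwC]] := forward_closure b (countableU hnull (countable1 1)).
have C1 : C 1 by apply: subC; right.
have hE x : 0 <= x -> x < 1 -> ~ C x -> l * g x = PF b g x + a.
  move=> x0 x1 Cx; apply/eqP; rewrite -subr_eq0; apply/negPn/negP => hN.
  apply: Cx; apply: subC; left => /=; split; first by rewrite in_itv /= x0 ltW.
  rewrite -[_ x]/(l * g x - PF b g x - (if 0 <= x < 1 then a else 0)).
  by rewrite x0 x1 -addrA -opprD.
pose good x := 0 <= x /\ (x < 1 -> ~ C x).
pose goods s := forall x, x \in s -> good x.
(* Extending by 0 beyond 1 makes every branch of a point admissible. *)
pose G : cfun R := fun x => if x < 1 then g x else 0.
have G_lt x : x < 1 -> G x = g x by rewrite /G => ->.
have G_ge x : 1 <= x -> G x = 0 by rewrite /G ltNge => ->.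
have good_branch k x : good x -> x < 1 -> good (branch b k x).
  move=> [x0 Cx] x1; split=> [|_ /forwC]; first exact: branch_ge0.
  by rewrite tau_branch //; exact: Cx.
have PFG x : good x -> x < 1 ->
    PF b g x = (b^-1)%:C * \sum_(k < Num.bound b) G (branch b k x).
  move=> [x0 Cx] x1; rewrite PF_E //; congr (_ * _); apply: eq_bigr => k _.
  rewrite /trunc1 /G le_eqVlt; have [E|//] := eqVneq (branch b k x) 1.
  by case: (Cx x1); rewrite -(@tau_branch R b k x) // E; exact: forwC.
have [m hm] := BV_dominates hBV.
pose S := [set v | exists z s, [/\ goods (z :: s), path <%O z s &
  v = pvar G z s]].
have ge1_pvar z s : path <%O z s -> 1 <= z -> pvar G z s = 0.
  elim: s z => //= y s IH z /andP[zy p] z1.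
  have y1 := le_trans z1 (ltW zy).
  by rewrite (IH _ p y1) !G_ge // subrr normc0 addr0.
have S0 : S 0.
  exists 1, [::]; split=> // x; rewrite inE => /eqP->; split=> //.
  by rewrite ltxx.
(* Approximation by lists that stay below 1; the jump to 0 at the end is
   replaced by a point close to 1. *)
have approx z s e : 0 < e -> goods (z :: s) -> path <%O z s -> z < 1 ->
    exists t, [/\ goods (z :: t), path <%O z t, last z t < 1 &
      pvar G z s <= pvar G z t + e].
  move=> e0; elim: s z => [|y s IH] z gs /=.
    by move=> _ z1; exists [::]; rewrite /= add0r (ltW e0).
  move=> /andP[zy p] z1.
  have gz : good z by apply: gs; rewrite mem_head.
  have gys : goods (y :: s) by move=> x h; apply: gs; rewrite inE h orbT.
  case: (ltP y 1) => y1.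
    have [t [h1 h2 h3 h4]] := IH _ gys p y1.
    exists (y :: t); split=> //=; rewrite ?zy //; last by rewrite -addrA lerD2l.
    by move=> x; rewrite inE => /orP[/eqP->//|]; exact: h1.
  have [d /andP[d0 d1] hd] := hlim _ e0.
  have mx1 : Num.max z d < 1 by rewrite gt_max z1 d1.
  have [w [zw w1 Cw]] := countable_dense cC mx1.
  move: zw; rewrite gt_max => /andP[zw dw].
  exists [:: w]; split=> //=; rewrite ?zw //.
    move=> x; rewrite !inE => /orP[/eqP->//|/eqP->].
    by split=> //; exact: le_trans d0 (ltW dw).
  rewrite (ge1_pvar y s p y1) (G_ge y y1) !addr0 sub0r normc_opp.
  rewrite !G_lt //; have := hd _ dw w1; rewrite subr0.
  by have := normc_rtriangle (g z) (g w); rewrite (normc_distC (g z)); lra.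
have hubS : has_ubound S.
  exists (m 1 - m 0 + 1) => _ [z [s [gs p ->]]].
  have [z0 _] : good z by apply: gs; rewrite mem_head.
  have [mn hm'] := hm.
  case: (ltP z 1) => z1; last first.
    by rewrite (ge1_pvar z s) // addr_ge0 ?subr_ge0 ?mn ?ler01.
  have [t [_ pt lt1 ht]] := approx z s 1 ltr01 gs p z1.
  apply: le_trans ht _; rewrite lerD2r.
  have Et : pvar G z t = pvar g z t.
    elim: (t) z {z0 z1 gs p} pt lt1 => //= y s' IH z /andP[zy p] l1.
    have y1 := le_lt_trans (lt_path_last p) l1.
    by rewrite IH // !G_lt // (lt_trans zy).
  rewrite Et; apply: le_trans (dominates_pvar hm z0 pt (ltW lt1)) _.
  by rewrite lerB ?mn // ltW.
pose V := sup S; have V0 : 0 <= V by apply: ub_le_sup.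
have VS z s : goods (z :: s) -> path <%O z s -> pvar G z s <= V.
  by move=> gs p; apply: ub_le_sup => //; exists z, s.
have contr z s : goods (z :: s) -> path <%O z s -> last z s < 1 ->
    normc l * pvar G z s <= b^-1 * V.
  move=> gs p l1.
  have z0 : 0 <= z by case: (gs z (mem_head _ _)).
  have Kpos : (0 < Num.bound b)%N.
    by rewrite -(ltr_nat R); apply: lt_trans (archi_boundP _); rewrite ?ltW.
  pose sm (x y : R) := \sum_(k < Num.bound b)
    normc (G (branch b k y) - G (branch b k x)).
  have step x y : good x -> good y -> x < 1 -> y < 1 ->
      normc l * normc (G y - G x) <= b^-1 * sm x y.
    move=> gx gy x1 y1; rewrite -normcM !G_lt // mulrBr.
    have [x0 Cx] := gx; have [y0 Cy] := gy.
    rewrite !hE ?PFG //; try exact: Cx; try exact: Cy.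
    rewrite opprD addrACA subrr addr0 -mulrBr -sumrB normcM.
    rewrite normc_real ger0_norm ?invr_ge0 ?(ltW b0) //.
    by rewrite ler_wpM2l ?invr_ge0 ?(ltW b0) // normc_sum.
  have : normc l * pvar G z s <= b^-1 *
      \sum_(k < Num.bound b) pvar G (branch b k z) [seq branch b k x | x <- s].
    elim: s z gs p l1 {z0} => [|y s IH] z gs /=.
      by rewrite big1 // !mulr0.
    move=> /andP[zy p] l1; have y1 := le_lt_trans (lt_path_last p) l1.
    rewrite big_split /= !mulrDr lerD //.
      apply: step => //; last exact: lt_trans zy y1.
        by apply: gs; rewrite mem_head.
      by apply: gs; rewrite inE mem_head orbT.
    by apply: IH => // x h; apply: gs; rewrite inE h orbT.
  move=> h; apply: le_trans h _; rewrite ler_wpM2l ?invr_ge0 ?(ltW b0) //.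
  rewrite -(prednK Kpos).
  have [h1 h2 h3 h4] := branchesP G b0 (Num.bound b).-1 p z0 l1.
  apply: le_trans h4 _; apply: VS => // y /h3[k [x [xs ->]]].
  have gx := gs x xs; apply: good_branch => //.
  apply: le_lt_trans l1.
  elim: (s) z x xs p {gx gs z0 h1 h2 h3} => [|y' s' IH] z x.
    by rewrite inE => /eqP->.
  rewrite inE => /orP[/eqP-> p|xs /= /andP[_ p]]; last exact: IH.
  exact: lt_path_last.
have l0 : 0 < normc l by apply: lt_trans bl; rewrite invr_gt0.
have hV : normc l * V <= b^-1 * V.
  rewrite mulrC -ler_pdivlMr //; apply: ge_sup => [|_ [z [s [gs p ->]]]].
    by exists 0.
  apply/ler_addgt0Pr => e e0.
  case: (ltP z 1) => z1; last first.
    rewrite (ge1_pvar z s) // addr_ge0 ?(ltW e0) // divr_ge0 ?normc_ge0 //.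
    by rewrite mulr_ge0 // invr_ge0 ltW.
  have [t [gt pt lt1 ht]] := approx z s e e0 gs p z1.
  apply: le_trans ht _; rewrite lerD2r ler_pdivlMr // mulrC.
  exact: contr.
have V_le0 : V <= 0.
  rewrite leNgt; apply/negP => Vpos; move: hV.
  by rewrite ler_pM2r // leNgt bl.
apply: subset_countable cC => x /= [x01 gx]; apply: contrapT => Cx.
move: x01; rewrite in_itv /= => /andP[x0 x1].
have {}x1 : x < 1.
  by rewrite lt_neqAle x1 andbT; apply/eqP => E; apply: Cx; rewrite E.
have : pvar G x [:: 1] <= 0.
  apply: le_trans V_le0; apply: VS; last by rewrite /= x1.
  move=> y; rewrite !inE => /orP[/eqP->|/eqP->]; first by split.
  by split=> //; rewrite ltxx.
rewrite /= addr0 (G_ge 1) // sub0r normc_opp G_lt // => h.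
by move: gx; rewrite -normc_gt0 ltNge h.
Qed.

End Contraction.

(** * Superpositions of indicators along the orbit of 1 *)

Section StepFunctions.
Variable R : realType.
Implicit Types (f g : cfun R) (a c : nat -> R[i]) (b x y t : R) (A : R).

Lemma is_csum_sum (I : Type) (r : seq I) (F : I -> nat -> R[i]) (s : I -> R[i]) :
  (forall k, is_csum (F k) (s k)) ->
  is_csum (fun n => \sum_(k <- r) F k n) (\sum_(k <- r) s k).
Proof.
move=> h; elim: r => [|k r IH].
  rewrite big_nil => e e0; exists 0%N => n _.
  by rewrite big1 ?subrr ?normc0 // => i _; rewrite big_nil.
rewrite big_cons; apply: is_csum_ext (is_csumD (h k) IH) => n.
by rewrite big_cons.
Qed.

(** The majorant is a complex series because the function dominating a
    superposition is itself the real part of one, see [BV_superpose]. *)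
Lemma is_csum_majorant c s (al : nat -> R) r : (forall n, normc (c n) <= al n) ->
  is_csum c s -> is_csum (fun n => (al n)%:C) r -> normc s <= complex.Re r.
Proof.
move=> hc hs hr; apply/ler_addgt0Pr => e e0.
have e2 : 0 < e / 2 by rewrite divr_gt0.
have [N hN] := hs _ e2; have [K hK] := hr _ e2.
have h1 := hN _ (leq_maxl N K); have h2 := hK _ (leq_maxr N K).
set n := maxn N K in h1 h2.
have h3 : normc (\sum_(i < n) c i) <= \sum_(i < n) al i.
  by apply: le_trans (normc_sum _ _ _) _; apply: ler_sum.
have := normc_rtriangle s (\sum_(i < n) c i); rewrite normc_distC => h4.
move: h2; rewrite -(rmorph_sum (@real_complex R)) => h2.
have := Re_le_normc ((\sum_(i < n) al i)%:C - r).
rewrite raddfB /= ler_norml => /andP[_ h6]; lra.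
Qed.

Lemma l1_tail a A : l1_le a A -> forall e : R, 0 < e ->
  exists N, forall n, \sum_(i < n) normc (a (N + i)%N) <= e.
Proof.
move=> hA e e0; have e2 : 0 < e / 2 by rewrite divr_gt0.
have [|l hl] := @real_series_cvg R (fun n => normc (a n)) A.
  move=> n; apply: le_trans (hA n); apply: ler_sum => i _.
  by rewrite ger0_norm ?normc_ge0.
have [N hN] := hl _ e2; exists N => n.
have := hN _ (leqnn N); have := hN _ (leq_addr n N).
rewrite big_split_ord /= !ltr_distlC; lra.
Qed.

Definition step t : cfun R := fun x => if 0 <= x < t then 1 else 0.

Lemma step_le1 t x : normc (step t x) <= 1.
Proof. by rewrite /step; case: ifP; rewrite ?normc0 ?normc1 ?ler01. Qed.

Definition orbit1 b n : R := iter n (tau b) 1.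
Definition digit b n : int := Num.floor (b * orbit1 b n).
Definition cdigit b n : R[i] := ((digit b n)%:~R : R)%:C.

Lemma orbit1_itv b n : 0 <= orbit1 b n <= 1.
Proof.
case: n => [|n]; first by rewrite lexx ler01.
by have /andP[-> /ltW ->] := tau_itv b (orbit1 b n).
Qed.

Lemma orbit1_lt1 b n : orbit1 b n.+1 < 1.
Proof. by have /andP[_ ->] := tau_itv b (orbit1 b n). Qed.

Lemma digit_ge0 b n : 0 < b -> 0 <= digit b n.
Proof.
move=> b0; have /andP[h _] := orbit1_itv b n.
by rewrite floor_ge0 mulr_ge0 // ltW.
Qed.

Lemma digit_le b n : 0 < b -> (digit b n)%:~R <= b.
Proof.
move=> b0; have /andP[h0 h] := orbit1_itv b n.
by apply: le_trans (floor_le _) _; rewrite ger_pMr.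
Qed.

Lemma cdigit_linf b : 0 < b -> linf_le (cdigit b) b.
Proof.
move=> b0 n; rewrite normc_real ger0_norm ?digit_le //.
by rewrite ler0z digit_ge0.
Qed.

(** A branch meets [0, t) wholly, not at all, or in the image of
    [0, tau b t). *)
Lemma sum_step_branch b t x : 1 < b -> 0 <= t <= 1 -> 0 <= x < 1 ->
  \sum_(k < Num.bound b) trunc1 (step t) (branch b k x) =
  ((Num.floor (b * t))%:~R : R)%:C + step (tau b t) x :> R[i].
Proof.
move=> b1 /andP[t0 t1] /andP[x0 x1]; have b0 : 0 < b by apply: lt_trans b1.
have bt0 : 0 <= b * t by rewrite mulr_ge0 // ltW.
have bK : b < (Num.bound b)%:R by apply: archi_boundP; exact: ltW.
have := bt0; rewrite -floor_ge0; case E : (Num.floor (b * t)) => [N|//] _.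
have := floor_itv (b * t); rewrite E intrD -pmulrn => /andP[N1 N2].
have NK : (N < Num.bound b)%N.
  rewrite -(ltr_nat R); apply: le_lt_trans bK; apply: le_trans N1 _.
  by rewrite ger_pMr.
have term k : trunc1 (step t) (branch b k x) = (if x + k%:R < b * t then 1 else 0).
  rewrite /trunc1 /step branch_ge0 //= {2}/branch ltr_pdivrMr // [t * b]mulrC.
  case: ltP => h; case: ifP => //; rewrite /branch ler_pdivrMr // => /negP[].
  by rewrite mul1r (le_trans (ltW h)) // ger_pMr.
under eq_bigr do rewrite term.
rewrite -(big_mkord xpredT (fun k => if x + k%:R < b * t then 1 else 0 : R[i])).
rewrite (big_cat_nat (n := N)) ?(ltnW NK) //= (big_ltn NK) /= addrA.
rewrite [X in _ + X = _]big_nat_cond [X in _ + X = _]big1 ?addr0; last first.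
  move=> k /andP[/andP[Nk _] _]; case: ifP => // h.
  have : (N.+1%:R : R) <= k%:R by rewrite ler_nat.
  by rewrite mulrS => h'; exfalso; lra.
congr (_ + _).
  rewrite big_nat_cond (eq_bigr (fun=> 1)); last first.
    move=> k /andP[/andP[_ kN] _]; rewrite ifT //.
    have : (k.+1%:R : R) <= N%:R by rewrite ler_nat.
    by rewrite mulrS; lra.
  rewrite -big_nat_cond sumr_const_nat subn0 pmulrn.
  by rewrite (rmorph_nat (@real_complex R)).
by rewrite /step x0 /= /tau E -pmulrn ltrBrDr.
Qed.

(** These functions contain all eigenfunctions: PF maps 1_[0, T_n) to a
    combination of 1_[0, T_(n+1)) and of the constant 1_[0, 1), hence acts on
    the coefficients a as the right shift up to a multiple of the constant. *)
Definition superpose b a : cfun R :=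
  fun x => pairing a (fun n => step (orbit1 b n) x).

Definition shiftr a n : R[i] := if n is n'.+1 then a n' else 0.

Lemma superposeP b a A x : l1_le a A ->
  is_csum (fun n => a n * step (orbit1 b n) x) (superpose b a x).
Proof.
by move=> hA; apply: (pairingP hA (B := 1)) => n; exact: step_le1.
Qed.

Lemma superposeE b a x s : is_csum (fun n => a n * step (orbit1 b n) x) s ->
  superpose b a x = s.
Proof. exact: csumE. Qed.

Lemma superpose_out b a x : ~~ (0 <= x < 1) -> superpose b a x = 0.
Proof.
move=> hx; apply: superposeE => e e0; exists 0%N => n _.
rewrite big1 ?subrr ?normc0 // => i _; rewrite /step ifF ?mulr0 //.
apply: contraNF hx => /andP[-> h]; apply: lt_le_trans h _.
by have /andP[] := orbit1_itv b i.
Qed.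

Lemma PF_superpose b a A : 1 < b -> l1_le a A ->
  PF b (superpose b a) = (b^-1)%:C *:
    (pairing a (cdigit b) *: step 1 + superpose b (shiftr a)).
Proof.
move=> b1 hA; have b0 : 0 < b by apply: lt_trans b1.
apply/funext => x; rewrite -[RHS]/((b^-1)%:C *
  (pairing a (cdigit b) * step 1 x + superpose b (shiftr a) x)).
have [x01|xN] := boolP (0 <= x < 1); last first.
  rewrite PF_out // superpose_out // addr0 /step ifF ?mulr0 //.
  exact: negbTE.
have /andP[x0 x1] := x01; rewrite PF_E //; congr (_ * _).
have hk k : is_csum (fun n => a n * trunc1 (step (orbit1 b n)) (branch b k x))
    (trunc1 (superpose b a) (branch b k x)).
  rewrite /trunc1; case: ifP => _; first exact: superposeP hA.
  move=> e e0; exists 0%N => n _.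
  by rewrite big1 ?subrr ?normc0 // => i _; rewrite mulr0.
apply: (is_csum_unique (is_csum_sum (index_enum 'I_(Num.bound b))
  (fun k => hk k))).
have h1 := pairingP hA (cdigit_linf b0).
have h2 : is_csum (fun n => a n * step (orbit1 b n.+1) x)
    (superpose b (shiftr a) x).
  have hA' : l1_le (shiftr a) A.
    case=> [|n]; first by have := hA 0%N; rewrite !big_ord0.
    by rewrite big_ord_recl [normc _]normc0 add0r; exact: hA.
  have := is_csum_behead (superposeP b x hA').
  by rewrite /= mul0r subr0.
have -> : step 1 x = 1 by rewrite /step x01.
rewrite mulr1; apply: is_csum_ext (is_csumD h1 h2) => n.
rewrite -mulrDr -mulr_sumr; congr (_ * _).
by rewrite sum_step_branch // orbit1_itv.
Qed.

Lemma BV_superpose b a A : l1_le a A -> BV (superpose b a).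
Proof.
move=> hA; pose al n : R[i] := (normc (a n))%:C.
have hal : l1_le al A.
  by move=> n; under eq_bigr do rewrite normc_real ger0_norm ?normc_ge0 //.
pose k (x : R) := Num.max 0 x.
have key u v : u <= v -> normc (superpose b a (k v) - superpose b a (k u)) <=
    complex.Re (superpose b al (k u)) - complex.Re (superpose b al (k v)).
  move=> uv; rewrite -raddfB.
  have kuv : k u <= k v by rewrite ge_max !le_max lexx uv orbT.
  have k0 x : 0 <= k x by rewrite le_max lexx.
  apply: (@is_csum_majorant (fun n => a n * step (orbit1 b n) (k v) -
      a n * step (orbit1 b n) (k u)) _ (fun n => normc (a n) *
      (if (k u < orbit1 b n) && ~~ (k v < orbit1 b n) then 1 else 0))).
  - move=> n; rewrite -mulrBr normcM ler_wpM2l ?normc_ge0 //.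
    rewrite /step !k0; case: (ltP (k u)) => hu; case: (ltP (k v)) => hv.
    + by rewrite subrr normc0.
    + by rewrite sub0r normc_opp normc1.
    + by have := lt_le_trans (le_lt_trans kuv hv) hu; rewrite ltxx.
    + by rewrite subrr normc0.
  - exact: is_csumB (superposeP b (k v) hA) (superposeP b (k u) hA).
  - apply: is_csum_ext (is_csumB (superposeP b (k u) hal)
      (superposeP b (k v) hal)) => n.
    rewrite -mulrBr (rmorphM (@real_complex R)); congr (_ * _).
    rewrite /step !k0 /=; case: (ltP (k u)) => hu; case: (ltP (k v)) => hv //=.
    + by rewrite subrr.
    + by rewrite subr0.
    + by have := lt_le_trans (le_lt_trans kuv hv) hu; rewrite ltxx.
    + by rewrite subrr.
apply/BVP; exists (fun x => - complex.Re (superpose b al (k x))).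
split=> [x y xy|u v u0 uv v1].
  rewrite lerN2 -subr_ge0; apply: le_trans (key _ _ xy); exact: normc_ge0.
have kE x : 0 <= x -> k x = x by move=> x0; rewrite /k max_r.
have := key _ _ uv; rewrite !kE ?(le_trans u0) // => h; lra.
Qed.

Lemma orbit1_bound b N : exists2 z, 0 <= z < 1 &
  forall i, (i < N)%N -> orbit1 b i.+1 <= z.
Proof.
elim: N => [|N [z /andP[z0 z1] hz]]; first by exists 0; rewrite ?lexx ?ltr01.
exists (Num.max z (orbit1 b N.+1)).
  by rewrite le_max z0 gt_max z1 orbit1_lt1.
move=> i; rewrite ltnS leq_eqVlt => /orP[/eqP->|/hz h].
  by rewrite le_max lexx orbT.
by rewrite le_max h.
Qed.

(** All T_n with n > 0 are below 1, so only the first term survives at 1-. *)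
Lemma left_lim1_superpose b a A : l1_le a A ->
  left_lim1 (superpose b a) (a 0%N).
Proof.
move=> hA e e0; have e2 : 0 < e / 2 by rewrite divr_gt0.
have hA1 : l1_le (fun n => a n.+1) A.
  move=> n; apply: le_trans (hA n.+1); rewrite [leRHS]big_ord_recl lerDr.
  exact: normc_ge0.
have [N hN] := l1_tail hA1 e2.
have [z z01 hz] := orbit1_bound b N.
exists z => // x zx x1; have z0 : 0 <= z by case/andP: z01.
have x0 : 0 <= x by exact: le_trans z0 (ltW zx).
have := is_csum_behead (superposeP b x hA).
rewrite {2}/step x0 x1 mulr1 => /is_csum_le h.
apply: (@le_lt_trans _ _ (e / 2)); last by lra.
apply: h => n; apply: le_trans (normc_sum _ _ _) _.
pose F i := normc (a i.+1 * step (orbit1 b i.+1) x).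
apply: (@le_trans _ _ (\sum_(i < N + n) F i)).
  rewrite addnC big_split_ord /= lerDl; apply: sumr_ge0 => i _.
  exact: normc_ge0.
rewrite big_split_ord /= big1 ?add0r => [|i _]; last first.
  rewrite /F /step [in X in if X then _ else _]ltNge.
  by rewrite (le_trans (hz i (ltn_ord i)) (ltW zx)) andbF mulr0 normc0.
apply: le_trans (hN n); apply: ler_sum => i _.
by rewrite /F normcM -[leRHS]mulr1 ler_wpM2l ?normc_ge0 ?step_le1.
Qed.

End StepFunctions.

(** * Generalized eigenspaces modulo null functions *)

Section QuotientDimension.
Variables (K : fieldType) (V : lmodType K) (N : set V).
Hypothesis N0 : N 0.
Hypothesis ND : forall u v, N u -> N v -> N (u + v).
Hypothesis NZ : forall (c : K) u, N u -> N (c *: u).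

(** Steinitz exchange modulo the subspace N: a matrix with more rows than
    columns has a left kernel. *)
Lemma free_mod_leq (m M : nat) (u : 'I_m -> V) (e : 'I_M -> V) :
  (forall c : 'I_m -> K, N (\sum_i c i *: u i) -> forall i, c i = 0) ->
  (forall j, exists c : 'I_M -> K, N (u j - \sum_i c i *: e i)) ->
  (m <= M)%N.
Proof.
move=> ufree uspan; have [A hA] := choice uspan.
rewrite leqNgt; apply/negP => Mm.
pose B : 'M[K]_(m, M) := \matrix_(j, i) A j i.
have : kermx B != 0.
  rewrite kermx_eq0 -row_leq_rank -ltnNge.
  exact: leq_ltn_trans (rank_leq_col B) Mm.
case/rowV0Pn => v /sub_kermxP vB v0.
case/negP: v0; apply/eqP/rowP => j; rewrite mxE; move: j.
apply: (ufree (fun j => v 0 j)).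
have NS (I : Type) (r : seq I) (P : pred I) (F : I -> V) : (forall i, N (F i)) ->
    N (\sum_(i <- r | P i) F i).
  by move=> h; elim/big_rec: _ => // i x _; exact: ND.
have := NS _ (index_enum 'I_m) xpredT _ (fun j => NZ (v 0 j) (hA j)).
under eq_bigr do rewrite scalerBr scaler_sumr.
rewrite sumrB exchange_big /= [X in _ - X]big1 ?subr0 // => i _.
under eq_bigr do rewrite scalerA.
have E : \sum_j v 0 j * A j i = (v *m B) 0 i.
  by rewrite mxE; apply: eq_bigr => j _; rewrite mxE.
by rewrite -scaler_suml E vB mxE scale0r.
Qed.

End QuotientDimension.

Section JordanChain.
Variable R : realType.
Variables (b : R) (l : R[i]).
Hypotheses (b1 : 1 < b) (bl : b^-1 < normc l).
Implicit Types (f g : cfun R) (a c : nat -> R[i]).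

Let b0 : 0 < b. Proof. exact: lt_trans b1. Qed.

Definition recip : R[i] := (b%:C * l)^-1.

Let l0 : l != 0.
Proof. by rewrite -normc_gt0; apply: lt_trans bl; rewrite invr_gt0. Qed.

Lemma recipE : (b^-1)%:C = l * recip.
Proof.
rewrite /recip invfM mulrCA mulfV // mulr1.
by rewrite (fmorphV (@real_complex R)).
Qed.

Lemma normc_recip_lt1 : normc recip < 1.
Proof.
rewrite normcV normcM normc_real gtr0_norm // invf_lt1.
  by rewrite mulrC -ltr_pdivrMr // mul1r.
by rewrite mulr_gt0 // normc_gt0.
Qed.

Let w1 := normc_recip_lt1.

Definition pencil : cfun R -> cfun R := fun g => l *: g - PF b g.

Lemma pencilD f g : pencil (f + g) = pencil f + pencil g.
Proof. by rewrite /pencil PFD // scalerDr opprD addrACA. Qed.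

Lemma pencilZ (c : R[i]) f : pencil (c *: f) = c *: pencil f.
Proof. by rewrite /pencil PFZ // scalerBr !scalerA mulrC. Qed.

Lemma pencil0 : pencil 0 = 0.
Proof. by rewrite -(scale0r 0) pencilZ !scale0r. Qed.

Lemma pencilB f g : pencil (f - g) = pencil f - pencil g.
Proof. by rewrite -scaleN1r pencilD pencilZ scaleN1r. Qed.

Lemma pencil_sum m (F : nat -> cfun R) :
  pencil (\sum_(k < m) F k) = \sum_(k < m) pencil (F k).
Proof.
elim: m => [|m IH]; first by rewrite !big_ord0 pencil0.
by rewrite !big_ord_recr pencilD IH.
Qed.

Lemma BV_pencil f : BV f -> BV (pencil f).
Proof. by move=> h; apply: BVB; [exact: BVZ|exact: BV_PF]. Qed.

Lemma BVnullB f g : BVnull f -> BVnull g -> BVnull (f - g).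
Proof. by move=> hf hg; rewrite -scaleN1r; apply: BVnullD => //; exact: BVnullZ. Qed.

Lemma BVnull_pencil f : BVnull f -> BVnull (pencil f).
Proof. by move=> h; apply: BVnullB; [exact: BVnullZ|exact: BVnull_PF]. Qed.

Lemma superpose_resolve a A : l1_le a A ->
  superpose b a = superpose b (resolve recip a) -
    recip *: superpose b (shiftr (resolve recip a)).
Proof.
move=> hA; have hr := resolve_l1 w1 hA; apply/funext => x.
rewrite -[RHS]/(superpose b (resolve recip a) x -
  recip * superpose b (shiftr (resolve recip a)) x).
have hs : l1_le (shiftr (resolve recip a)) ((1 - normc recip)^-1 * A).
  case=> [|n]; first by have := hr 0%N; rewrite !big_ord0.
  by rewrite big_ord_recl [normc _]normc0 add0r; exact: hr.
apply: superposeE.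
apply: is_csum_ext (is_csumB (superposeP b x hr)
  (is_csumZ recip (superposeP b x hs))) => -[|n] /=.
  by rewrite mul0r mulr0 subr0.
by rewrite mulrA -mulrBl addrK.
Qed.

Lemma pencil_superpose a A : l1_le a A ->
  pencil (superpose b (resolve recip a)) = l *: superpose b a -
    (l * recip * pairing (resolve recip a) (cdigit b)) *: step 1.
Proof.
move=> hA; rewrite /pencil (PF_superpose b1 (resolve_l1 w1 hA)) recipE.
rewrite (superpose_resolve hA) scalerDr opprD addrA scalerBr !scalerA.
by rewrite addrAC.
Qed.

Definition delta n : R[i] := (n == 0)%N%:R.

Lemma delta_l1 : l1_le delta 1.
Proof.
case=> [|n]; first by rewrite big_ord0 ler01.
rewrite big_ord_recl big1 ?addr0 => [|i _]; last exact: normc0.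
by rewrite [normc _]normc1.
Qed.

Lemma superpose_delta : superpose b delta = step 1.
Proof.
apply/funext => x; apply: superposeE.
have := is_csum_finite (a := fun n => delta n * step (orbit1 b n) x) (N := 1).
rewrite big_ord1 mul1r; apply=> -[//|n] _.
by rewrite mul0r.
Qed.

Lemma pairing_delta c : pairing delta c = c 0%N.
Proof.
apply: csumE.
have := is_csum_finite (a := fun n => delta n * c n) (N := 1).
rewrite big_ord1 mul1r; apply=> -[//|n] _.
by rewrite mul0r.
Qed.

(** (1 - w0 S)^-(k+1) applied to the first basis vector, that is the sequence
    binomial(n+k, k) w0^n; the recursive form makes PF act on it transparently.
    The functions [jordan 0], ..., [jordan k] span the same space as the
    derivatives of order at most k at w0 of sum_n w^n 1_[0, T_n). *)
Definition chain k : nat -> R[i] := iter k.+1 (resolve recip) delta.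

Lemma chain_l1 k : exists A, l1_le (chain k) A.
Proof.
elim: k => [|k [A hA]]; first by eexists; exact: resolve_l1 delta_l1.
by eexists; exact: (resolve_l1 w1 hA).
Qed.

Lemma chain0 k : chain k 0%N = 1.
Proof. by elim: k. Qed.

Definition jordan k : cfun R := superpose b (chain k).

Lemma BV_jordan k : BV (jordan k).
Proof. by have [A h] := chain_l1 k; exact: BV_superpose h. Qed.

Lemma left_lim1_jordan k : left_lim1 (jordan k) 1.
Proof.
by have [A h] := chain_l1 k; rewrite -(chain0 k); exact: left_lim1_superpose h.
Qed.

Definition digit_tails k := iter k (tails recip) (cdigit b).

Lemma iter_tails_linf k c B : linf_le c B ->
  exists B', linf_le (iter k (tails recip) c) B'.
Proof.
move=> hB; elim: k => [|k [B' h]]; first by exists B.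
by eexists; exact: tails_le h.
Qed.

Lemma pairing_chain k c B : linf_le c B ->
  pairing (chain k) c = ps (iter k (tails recip) c) recip.
Proof.
elim: k c B => [|k IH] c B hB.
  by rewrite (pairing_resolve w1 delta_l1 hB) pairing_delta.
have [A hA] := chain_l1 k.
rewrite -[chain k.+1]/(resolve recip (chain k)) (pairing_resolve w1 hA hB).
by rewrite (IH _ _ (tails_le w1 hB)) iterSr.
Qed.

(** What keeps [jordan] from being a Jordan chain; see [pencil_jordan0] and
    [pencil_jordanS]. Up to the factor l these are the coefficients of the
    expansion of 1 - sum_n d_n w^(n+1) in powers of 1 - w0 / w. *)
Definition defect k : R[i] :=
  if k is 0 then l * (1 - recip * ps (cdigit b) recip)
  else - (l * recip * ps (digit_tails k) recip).

Arguments defect : simpl never.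

Lemma pencil_jordan0 : pencil (jordan 0) = defect 0 *: step 1.
Proof.
rewrite /jordan (pencil_superpose delta_l1) superpose_delta.
rewrite -[resolve _ _]/(chain 0) (pairing_chain 0 (cdigit_linf b0)).
by rewrite -scalerBl /defect mulrBr mulr1 mulrA.
Qed.

Lemma pencil_jordanS k :
  pencil (jordan k.+1) = l *: jordan k + defect k.+1 *: step 1.
Proof.
have [A hA] := chain_l1 k.
rewrite /jordan (pencil_superpose hA) -[resolve _ _]/(chain k.+1).
by rewrite (pairing_chain k.+1 (cdigit_linf b0)) -scaleNr.
Qed.

Lemma left_lim1_step1 : left_lim1 (step (1 : R)) 1.
Proof.
move=> e e0; exists 0 => [|x x0 x1]; first by rewrite lexx ltr01.
by rewrite /step (ltW x0) x1 subrr normc0.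
Qed.

(** Modulo null functions, [jordan 0] is the only candidate for an eigenvector:
    subtracting a multiple of it kills the value at 1-, after which the
    contraction leaves nothing. *)
Lemma pencil_step1 f (a : R[i]) : BV f -> BVnull (pencil f - a *: step 1) ->
  exists c : R[i], BVnull (f - c *: jordan 0) /\ a = c * defect 0.
Proof.
move=> hf hN; have [c hc] := BV_left_lim1 hf; exists c.
set g := f - _; set a' := a - c * defect 0.
have hg : BV g by apply: BVB => //; exact/BVZ/BV_jordan.
have gl : left_lim1 g 0.
  rewrite -(subrr c) -{2}(mulr1 c) /g -scaleNr -mulNr.
  exact: left_lim1D hc (left_lim1Z _ (left_lim1_jordan 0)).
have Tg : BVnull (pencil g - a' *: step 1).
  rewrite /g pencilB pencilZ pencil_jordan0 scalerA /a' scalerBl.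
  by rewrite opprB addrA subrK.
have gN : BVnull g.
  split=> //; apply: (@resolvent_null R b l a' g) => //; case: Tg => _.
  suff -> : (fun x : R => if 0 <= x < 1 then a' else 0 : R[i]^o) = a' *: step 1.
    by [].
  apply/funext => x; rewrite -[RHS]/(a' * step 1 x) /step.
  by case: ifP; rewrite ?mulr1 ?mulr0.
split=> //; apply/eqP; rewrite -subr_eq0 -/a'; apply/eqP.
apply: (@left_lim1_null R (a' *: step 1)).
  have := BVnullB (BVnull_pencil gN) Tg.
  by rewrite opprB addrC subrK => -[].
by have := left_lim1Z a' left_lim1_step1; rewrite mulr1.
Qed.

(** An eigenvector is a non-zero multiple of [jordan 0] modulo null functions,
    so [jordan 0] must itself be an eigenvector. *)
Lemma eigenvalue_defect0 : PF_eigenvalue b l -> defect 0 = 0.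
Proof.
move=> [f [hf fN hN]].
have hN' : BVnull (pencil f - 0 *: step 1).
  by rewrite scale0r subr0 /pencil -opprB -scaleN1r; exact: BVnullZ.
have [c [h1 /esym/eqP]] := pencil_step1 hf hN'.
rewrite mulf_eq0 => /orP[/eqP c0|/eqP//]; case: fN.
by move: h1; rewrite c0 scale0r subr0.
Qed.

Section Order.
Variable m : nat.
Hypothesis defect_lt : forall k, (k < m)%N -> defect k = 0.

Lemma iter_pencilZ n (c : R[i]) f : iter n pencil (c *: f) = c *: iter n pencil f.
Proof. by elim: n => //= n ->; exact: pencilZ. Qed.

Lemma iter_pencil_jordan k : (k < m)%N -> iter k.+1 pencil (jordan k) = 0.
Proof.
elim: k => [|k IH] km.
  by rewrite /= pencil_jordan0 defect_lt // scale0r.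
rewrite iterSr pencil_jordanS defect_lt // scale0r addr0 iter_pencilZ.
by rewrite IH ?scaler0 // ltnW.
Qed.

Lemma jordan_gen k : (k < m)%N -> gen_eigenspace b l (jordan k).
Proof.
move=> km; split; first exact: BV_jordan.
by exists k.+1; split=> //; rewrite iter_pencil_jordan //; exact: BVnull0.
Qed.

Lemma pencil_comb n (c : nat -> R[i]) : (n < m)%N ->
  pencil (\sum_(k < n.+1) c k *: jordan k) =
  \sum_(k < n) (l * c k.+1) *: jordan k.
Proof.
move=> nm; rewrite (pencil_sum n.+1 (fun k => c k *: jordan k)) big_ord_recl.
rewrite pencilZ pencil_jordan0 defect_lt ?(leq_trans _ nm) //.
rewrite scale0r scaler0 add0r; apply: eq_bigr => k _.
rewrite pencilZ pencil_jordanS defect_lt.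
  by rewrite scale0r addr0 scalerA mulrC.
by rewrite (leq_trans _ nm) // !ltnS.
Qed.

Lemma jordan_free n (c : nat -> R[i]) : (n <= m)%N ->
  BVnull (\sum_(k < n) c k *: jordan k) -> forall k, (k < n)%N -> c k = 0.
Proof.
elim: n c => [//|n IH] c nm hN.
have cS k : (k < n)%N -> c k.+1 = 0.
  move=> kn; have := BVnull_pencil hN; rewrite pencil_comb // => hN'.
  have /eqP := IH (fun k => l * c k.+1) (ltnW nm) hN' k kn.
  by rewrite mulf_eq0 (negPf l0) => /eqP.
case=> [_|k]; last by rewrite ltnS; exact: cS.
move: hN; rewrite big_ord_recl big1 ?addr0 => [|i _]; last first.
  by rewrite cS ?scale0r.
case=> _ /left_lim1_null; apply.
by have := left_lim1Z (c 0%N) (left_lim1_jordan 0); rewrite mulr1.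
Qed.

(** Induction on the nilpotency index: a preimage of a combination of the chain
    under the pencil is the shifted combination, up to [jordan 0]; the first
    non-zero defect forbids going beyond index m - 1. *)
Lemma jordan_span n f : defect m != 0 -> BV f -> BVnull (iter n pencil f) ->
  exists c : nat -> R[i], BVnull (f - \sum_(k < m) c k *: jordan k).
Proof.
move=> dm; elim: n f => [|n IH] f hf hN.
  exists (fun=> 0); rewrite big1 ?subr0 // => i _; exact: scale0r.
rewrite iterSr in hN; have [c hc] := IH _ (BV_pencil hf) hN.
pose S := \sum_(k < m) (l^-1 * c k) *: jordan k.+1.
pose a := \sum_(k < m) l^-1 * c k * defect k.+1.
have TS : pencil S = \sum_(k < m) c k *: jordan k + a *: step 1.
  rewrite /S (pencil_sum m (fun k => (l^-1 * c k) *: jordan k.+1)).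
  rewrite /a scaler_suml -big_split; apply: eq_bigr => k _ /=.
  rewrite pencilZ pencil_jordanS scalerDr !scalerA.
  by rewrite mulrAC mulVf // mul1r.
have hfS : BV (f - S).
  by apply: BVB => //; apply: BV_sum => k _; exact/BVZ/BV_jordan.
have hTS : BVnull (pencil (f - S) - (- a) *: step 1).
  by rewrite pencilB TS scaleNr opprK opprD addrA subrK.
have [c' [h1 h2]] := pencil_step1 hfS hTS.
rewrite /S /a in h1 h2; case: (m) defect_lt dm h1 h2 => [|m'] dlt dm h1 h2.
  move: h2; rewrite big_ord0 oppr0 => /esym/eqP.
  rewrite mulf_eq0 (negPf dm) orbF => /eqP c'0.
  by exists (fun=> 0); move: h1; rewrite !big_ord0 c'0 scale0r !subr0.
move: h2; rewrite dlt // mulr0 big_ord_recr /= big1 ?add0r => [|k _]; last first.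
  by rewrite dlt ?mulr0 // ltnS.
move=> /eqP; rewrite oppr_eq0 !mulf_eq0 (negPf dm) invr_eq0 (negPf l0) orbF /=.
move=> /eqP cm; exists (fun k => if k is k'.+1 then l^-1 * c k' else c').
rewrite big_ord_recl; move: h1; rewrite big_ord_recr /= cm mulr0 scale0r addr0.
by rewrite opprD addrA addrAC.
Qed.

End Order.

(** The algebraic multiplicity is the number of leading defects that vanish,
    because the Jordan chain breaks exactly at the first non-zero defect. *)
Lemma multiplicity_defect M : eigenvalue_multiplicity b l M ->
  (forall k, (k < M)%N -> defect k = 0) /\ defect M != 0.
Proof.
move=> [e [eE efree espan]].
have free_le m : (forall k, (k < m)%N -> defect k = 0) -> (m <= M)%N.
  move=> hm.
  apply: (@free_mod_leq (R[i] : fieldType) (cfun R : lmodType R[i]) _ (BVnull0 R)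
    (@BVnullD R) (@BVnullZ R) m M (fun k => jordan k) e).
    move=> c hc i.
    pose c' (k : nat) := if insub k is Some i then c i else 0.
    have c'E (j : 'I_m) : c' j = c j by rewrite /c' valK.
    rewrite -c'E; apply: (jordan_free hm (leqnn m)) (ltn_ord i).
    by under eq_bigr do rewrite c'E.
  by move=> j; apply: espan; exact: jordan_gen hm _ (ltn_ord j).
have exd : exists k, defect k != 0.
  apply: contrapT => /forallNP h.
  suff : (M.+1 <= M)%N by rewrite ltnn.
  by apply: free_le => k _; apply/eqP/negPn/negP; exact: h.
have [m dm mmin] := ex_minnP exd.
have hm k : (k < m)%N -> defect k = 0.
  by move=> km; apply/eqP/negPn/negP => /mmin; rewrite leqNgt km.
suff -> : M = m by [].
apply/eqP; rewrite eqn_leq free_le // andbT.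
apply: (@free_mod_leq (R[i] : fieldType) (cfun R : lmodType R[i]) _ (BVnull0 R)
  (@BVnullD R) (@BVnullZ R) M m e (fun k => jordan k)) => // j.
have [hj [n [_ hn]]] := eE j.
have [c hc] := jordan_span hm dm hj hn.
by exists (fun k => c k).
Qed.

End JordanChain.

(** * The zero of the kneading series *)

Section ZeroOrder.
Variable R : realType.
Variables (b : R) (l : R[i]).
Hypotheses (b1 : 1 < b) (bl : b^-1 < normc l).

Let b0 : 0 < b. Proof. exact: lt_trans b1. Qed.

(** This is (1 - b w) psi_b(b w), where psi_b(z) = sum_n T_n (z / b)^n, so its
    zeros in the unit disc other than 1/b are those of psi_b rescaled. *)
Definition kneading w : R[i] := 1 - w * ps (cdigit b) w.

Local Notation w0 := (recip b l).
Local Notation h := (digit_tails b l).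

Let w01 : normc w0 < 1. Proof. exact: normc_recip_lt1. Qed.

Lemma recip_neq0 : w0 != 0.
Proof.
rewrite invr_eq0 mulf_neq0 //; last first.
  by rewrite -normc_gt0; apply: lt_trans bl; rewrite invr_gt0.
by rewrite -normc_gt0 normc_real normr_gt0 gt_eqF.
Qed.

Let l0 : l != 0.
Proof. by rewrite -normc_gt0; apply: lt_trans bl; rewrite invr_gt0. Qed.

Lemma defect0_kneading : defect b l 0 = 0 -> kneading w0 = 0.
Proof.
by rewrite /defect => /eqP; rewrite mulf_eq0 (negPf l0) => /eqP.
Qed.

(** Iterated division by w - w0; the remainders are the defects. *)
Lemma kneading_factor j w : normc w < 1 ->
  (forall k, (k <= j)%N -> defect b l k = 0) ->
  w ^+ j * kneading w = - ((w - w0) ^+ j.+1 * ps (h j.+1) w).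
Proof.
move=> w1; elim: j => [|j IH] hd.
  have := defect0_kneading (hd 0%N isT); rewrite /kneading => k0.
  rewrite mul1r expr1 (ps_tails w01 w1 (cdigit_linf b0)) -[ps (tails _ _) w]/(ps (h 1) w).
  have -> : w0 * ps (cdigit b) w0 = 1 by apply/esym/eqP; rewrite -subr_eq0 k0.
  by rewrite opprD addrCA subrr addr0.
have [B hB] := iter_tails_linf b1 bl j.+1 (cdigit_linf b0).
have d0 : w0 * ps (h j.+1) w0 = 0.
  have /eqP := hd j.+1 (leqnn _); rewrite /defect oppr_eq0 -mulrA mulf_eq0.
  by rewrite (negPf l0) => /eqP.
rewrite exprS -mulrA IH => [|k kj]; last by apply: hd; exact: leqW.
rewrite mulrN mulrCA (ps_tails w01 w1 hB) d0 addr0.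
by rewrite mulrA -exprSr.
Qed.

(** The first non-zero defect is the value at w0 of the last quotient, so M is
    the order of the zero w0. *)
Lemma kneading_order M : (0 < M)%N ->
  (forall k, (k < M)%N -> defect b l k = 0) -> defect b l M != 0 ->
  exists C d : R, [/\ 0 < C, 0 < d & forall w, normc (w - w0) < d ->
    [/\ normc (w - w0) ^+ M <= C * normc (kneading w),
        normc (kneading w) <= C * normc (w - w0) ^+ M &
        normc w < 1]].
Proof.
case: M => // m _ hd dM.
have [B hB] := iter_tails_linf b1 bl m.+1 (cdigit_linf b0).
have B0 := linf_le_ge0 hB.
have w0gt0 : 0 < normc w0 by rewrite normc_gt0 recip_neq0.
have c0 : 0 < normc (ps (h m.+1) w0).
  by rewrite normc_gt0; apply: contraNneq dM => E; rewrite /defect E mulr0 oppr0.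
set c := normc _ in c0.
pose s : R := (1 - normc w0) / 2; have s0 : 0 < s by rewrite divr_gt0 // subr_gt0.
pose L : R := s^-1 * ((1 - normc w0)^-1 * B).
have L0 : 0 <= L.
  by rewrite !mulr_ge0 // invr_ge0 ?subr_ge0 ltW.
exists (Num.max (2 / c) ((s^-1 * B + 1) / (normc w0 / 2) ^+ m)).
exists (Num.min s (Num.min (normc w0 / 2) (c / (2 * (L + 1))))).
split; first by rewrite lt_max divr_gt0.
  rewrite !lt_min s0 !divr_gt0 // mulr_gt0 //; lra.
move=> w; rewrite !lt_min => /and3P[ws wh wc].
have hw := normc_rtriangle w w0; have hw' := normc_rtriangle w0 w.
rewrite (normc_distC w0) in hw'.
have w1 : normc w < 1 by rewrite /s in ws; lra.
have sw : s <= 1 - normc w by rewrite /s in ws *; lra.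
have hinv : (1 - normc w)^-1 <= s^-1.
  by rewrite lef_pV2 // posrE // subr_gt0.
have := kneading_factor w1 (fun k (kj : (k <= m)%N) => hd k kj).
move=> /(congr1 (@normc R)); rewrite normc_opp !normcM !normcX => E.
have hlow : c / 2 <= normc (ps (h m.+1) w).
  have h1 := ps_lipschitz w01 w1 hB.
  have h2 : normc (w - w0) * L <= c / 2.
    apply: (@le_trans _ _ (c / (2 * (L + 1)) * L)).
      by rewrite ler_wpM2r // ltW.
    rewrite mulrAC ler_pdivrMr; last by lra.
    have -> : c / 2 * (2 * (L + 1)) = c * L + c by field.
    by rewrite lerDl ltW.
  have h3 : normc (w - w0) * ((1 - normc w)^-1 * ((1 - normc w0)^-1 * B)) <=
      normc (w - w0) * L.
    rewrite ler_wpM2l ?normc_ge0 // ler_wpM2r //.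
    by rewrite mulr_ge0 // invr_ge0 subr_ge0 ltW.
  have := normc_rtriangle (ps (h m.+1) w0) (ps (h m.+1) w).
  by rewrite -/c (normc_distC (ps _ w0)); lra.
have hup : normc (ps (h m.+1) w) <= s^-1 * B + 1.
  by have := ps_le hB w1; have := ler_wpM2r B0 hinv; lra.
have wm1 : normc w ^+ m <= 1 by rewrite exprn_ile1 ?normc_ge0 // ltW.
have wm2 : (normc w0 / 2) ^+ m <= normc w ^+ m.
  by rewrite lerXn2r ?nnegrE ?normc_ge0 ?divr_ge0 ?normc_ge0 //; lra.
have pm0 : 0 < (normc w0 / 2) ^+ m by rewrite exprn_gt0 // divr_gt0.
have k0 := normc_ge0 (kneading w); have d0 : 0 <= normc (w - w0) ^+ m.+1.
  by rewrite exprn_ge0 // normc_ge0.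
split=> //.
  apply: (@le_trans _ _ (2 / c * normc (kneading w))); last first.
    by rewrite ler_wpM2r // le_max lexx.
  rewrite mulrAC ler_pdivlMr // mulrC.
  have := ler_wpM2l d0 hlow; rewrite -E => h1.
  have := ler_wpM2r k0 wm1; rewrite mul1r => h2; lra.
apply: (@le_trans _ _ ((s^-1 * B + 1) / (normc w0 / 2) ^+ m *
    normc (w - w0) ^+ m.+1)); last first.
  by rewrite ler_wpM2r // le_max lexx orbT.
rewrite mulrAC ler_pdivlMr // mulrC [leRHS]mulrC.
apply: le_trans (ler_wpM2r k0 wm2) _; rewrite E.
exact: ler_wpM2l.
Qed.

End ZeroOrder.

Section UnitDisc.
Variable R : realType.

Lemma orbit1S (b : R) n :
  orbit1 b n.+1 = b * orbit1 b n - (digit b n)%:~R.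
Proof. by []. Qed.

(** The digits form an expansion of 1 in base b, so a zero of the kneading
    series in the closed disc of radius 1/b can only be 1/b itself. *)
Lemma eigenvalue_lt1 (b : R) (l : R[i]) : 1 < b -> b^-1 < normc l ->
  kneading b (recip b l) = 0 -> l != 1 -> normc l < 1.
Proof.
move=> b1 bl k0; rewrite ltNge; apply: contraNN => l1.
have b0 : 0 < b by apply: lt_trans b1.
set w := recip b l in k0; have w1 : normc w < 1 by exact: normc_recip_lt1.
have wb : normc w <= b^-1.
  rewrite normcV normcM normc_real gtr0_norm // invfM ger_pMr ?invr_gt0 //.
  by rewrite invf_le1 // (lt_le_trans ltr01).
have d0 : 1 <= (digit b 0)%:~R :> R.
  by rewrite ler1z -gtz0_ge1 /digit floor_gt0 mulr1 ltW.
have expansion n : \sum_(i < n) (digit b i)%:~R * b^-1 ^+ i.+1 <= 1.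
  suff -> : \sum_(i < n) (digit b i)%:~R * b^-1 ^+ i.+1 =
      1 - orbit1 b n * b^-1 ^+ n.
    rewrite gerBl mulr_ge0 ?exprn_ge0 ?invr_ge0 ?(ltW b0) //.
    by have /andP[] := orbit1_itv b n.
  elim: n => [|n IH]; first by rewrite big_ord0 mulr1 subrr.
  rewrite orbit1S [RHS]/= big_ord_recr /= IH exprS.
  by set u := _ ^+ n; field; rewrite gt_eqF.
have hre : b^-1 <= complex.Re w.
  have hs := is_csumZ w (psP (cdigit_linf b0) w1).
  have E1 : w * ps (cdigit b) w = 1 by apply/esym/eqP; rewrite -subr_eq0 -[_ - _]/(kneading b w) k0.
  rewrite E1 in hs.
  suff : 0 <= (digit b 0)%:~R * (complex.Re w - b^-1).
    by rewrite pmulr_rge0 ?subr_ge0 // (lt_le_trans ltr01).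
  apply/ler_addgt0Pr => e e0; have [N /(_ _ (leqnSn N)) hN] := hs _ e0.
  have := Re_le_normc (\sum_(i < N.+1) w * (w ^+ i * cdigit b i) - 1).
  rewrite raddfB raddf_sum big_ord_recl /= => hR.
  have := expansion N.+1; rewrite big_ord_recl /= expr1 => hE.
  have hterms : \sum_(i < N) complex.Re (w * (w ^+ i.+1 * cdigit b i.+1)) <=
      \sum_(i < N) (digit b i.+1)%:~R * b^-1 ^+ i.+2.
    apply: ler_sum => i _; apply: le_trans (ler_norm _) _.
    apply: le_trans (Re_le_normc _) _.
    rewrite mulrA -exprS normcM normcX mulrC normc_real ger0_norm.
      rewrite ler_wpM2l ?ler0z ?digit_ge0 // lerXn2r ?nnegrE ?normc_ge0 //.
      by rewrite invr_ge0 ltW.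
    by rewrite ler0z digit_ge0.
  have hfirst : complex.Re (w * (w ^+ 0 * cdigit b 0)) =
      (digit b 0)%:~R * complex.Re w.
    by rewrite expr0 mul1r /cdigit; case: (w) => x y /=; rewrite mulr0 subr0 mulrC.
  move: hR; rewrite hfirst ler_norml => /andP[hR _]; lra.
have Ew : w = (b^-1)%:C.
  case: (w) hre wb => x y /= hx hxy.
  have binv : 0 < b^-1 by rewrite invr_gt0.
  have x0 : 0 <= x by apply: le_trans hx; exact: ltW.
  have hs : x ^+ 2 + y ^+ 2 <= b^-1 ^+ 2.
    rewrite -[leLHS]sqr_sqrtr ?addr_ge0 ?sqr_ge0 //.
    by rewrite lerXn2r ?nnegrE ?sqrtr_ge0 // ltW.
  have hx2 : b^-1 ^+ 2 <= x ^+ 2 by rewrite lerXn2r ?nnegrE // ltW.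
  have y0 : y ^+ 2 = 0 by apply/eqP; rewrite eq_le sqr_ge0 andbT; lra.
  have /eqP := y0; rewrite sqrf_eq0 => /eqP ->; congr (_ +i* _).
  apply/eqP; rewrite eq_le hx andbT -(@ler_pXn2r _ 2) ?nnegrE ?(ltW binv) //.
  by rewrite y0 addr0 in hs.
have := recipE b1 bl; rewrite -/w Ew => E.
have bC : (b^-1)%:C != 0 :> R[i].
  by rewrite -normc_gt0 normc_real normr_gt0 invr_eq0 gt_eqF.
by apply/eqP/(mulIf bC); rewrite mul1r -E.
Qed.

End UnitDisc.

(** * Greedy and quasi-greedy expansions of 1 *)

Section Expansions.
Variable R : realType.
Implicit Types (x y b : R) (k : nat -> int).

(** Polynomials in the base y; as long as they stay in [0, 1) they agree with
    the orbit of 1 and k is the digit sequence of y, see [orbit1_affine]. *)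
Fixpoint affine_orbit k y n : R :=
  if n is n'.+1 then y * affine_orbit k y n' - (k n')%:~R else 1.

Section Comparison.
Variables (x y : R) (s t : nat -> R) (k : nat -> int) (n : nat).
Hypotheses (x1 : 1 <= x) (xy : x <= y) (s0 : s 0%N = 1) (t0 : t 0%N = 1).
Hypothesis sS : forall i, (i < n)%N -> s i.+1 = x * s i - (k i)%:~R.
Hypothesis tS : forall i, (i < n)%N -> t i.+1 = y * t i - (k i)%:~R.
Hypothesis s_ge0 : forall i, (i < n)%N -> 0 <= s i.

(** While the digits agree, the gap between the orbits is multiplied by y and
    increased by (y - x) s_i at each step. *)
Lemma expansion_gap_ge i : (i < n)%N -> y ^+ i * (y - x) <= t i.+1 - s i.+1.
Proof.
elim: i => [|i IH] i_n.
  by rewrite sS // tS // s0 t0 mul1r; lra.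
have := IH (ltnW i_n); rewrite (sS i_n) (tS i_n) exprS => h.
have y0 : 0 <= y := le_trans ler01 (le_trans x1 xy).
have := ler_wpM2l y0 h.
have : 0 <= (y - x) * s i.+1 by rewrite mulr_ge0 ?s_ge0 // subr_ge0.
by move: (_ ^+ i) h => u h; lra.
Qed.

Lemma expansion_mono i : (i <= n)%N -> s i <= t i.
Proof.
case: i => [|i] i_n; first by rewrite s0 t0.
rewrite -subr_ge0; apply: le_trans (expansion_gap_ge i_n).
by rewrite mulr_ge0 ?exprn_ge0 ?subr_ge0 // (le_trans ler01) // (le_trans x1).
Qed.

Hypothesis y1 : 1 < y.
Hypothesis s_le1 : forall i, (i <= n)%N -> s i <= 1.

Lemma expansion_gap_le i : (i <= n)%N ->
  t i - s i <= (y - x) * ((y ^+ i - 1) / (y - 1)).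
Proof.
have y10 : y - 1 != 0 by rewrite subr_eq0 gt_eqF.
elim: i => [|i IH] i_n; first by rewrite s0 t0 !subrr mul0r mulr0.
rewrite (sS i_n) (tS i_n).
have y0 : 0 <= y := le_trans ler01 (le_trans x1 xy).
have := ler_wpM2l y0 (IH (ltnW i_n)).
have : (y - x) * s i <= (y - x) * 1.
  by rewrite ler_wpM2l ?subr_ge0 // s_le1 // ltnW.
rewrite (_ : (y - x) * ((y ^+ i.+1 - 1) / (y - 1)) =
   y * ((y - x) * ((y ^+ i - 1) / (y - 1))) + (y - x)).
  by move: (_ / (y - 1)) => z; lra.
by rewrite exprS; field.
Qed.

(** The same estimate for the orbits before the digit is subtracted, which is
    where the first difference of digits shows. *)
Lemma expansion_next_gap :
  y * t n - x * s n <= (y - x) * (y ^+ n.+1 / (y - 1)).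
Proof.
have y0 : 0 <= y := le_trans ler01 (le_trans x1 xy).
have y10 : y - 1 != 0 by rewrite subr_eq0 gt_eqF.
have h := ler_wpM2l y0 (expansion_gap_le (leqnn n)).
have h1 : (y - x) * s n <= (y - x) * 1.
  by rewrite ler_wpM2l ?subr_ge0 // s_le1.
have h2 : 0 <= (y - x) / (y - 1) by rewrite divr_ge0 ?subr_ge0 // ltW.
have -> : (y - x) * (y ^+ n.+1 / (y - 1)) =
    y * ((y - x) * ((y ^+ n - 1) / (y - 1))) + (y - x) + (y - x) / (y - 1).
  by rewrite exprS; field.
by move: (_ / (y - 1)) h h1 ((y - x) / (y - 1)) h2 => z h h1 z' h2; lra.
Qed.

End Comparison.

Lemma archi_expr b A : 1 < b -> exists n, A < b ^+ n.
Proof.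
move=> b1; have [n hn] : exists n : nat, A / (b - 1) < n%:R.
  exists (Num.bound `|A / (b - 1)|); apply: le_lt_trans (ler_norm _) _.
  exact: archi_boundP.
exists n; apply: (@lt_le_trans _ _ (1 + n%:R * (b - 1))).
  move: hn; rewrite ltr_pdivrMr ?subr_gt0 //; lra.
elim: n {hn} => [|n IH]; first by rewrite mul0r addr0.
rewrite exprS mulrS.
have h : b * (1 + n%:R * (b - 1)) <= b * b ^+ n by rewrite ler_wpM2l //; lra.
apply: le_trans h; have : 0 <= (n%:R : R) * (b - 1) ^+ 2.
  by rewrite mulr_ge0 // sqr_ge0.
rewrite expr2; lra.
Qed.

(** Expansions of 1 in two different bases separate exponentially, so their
    digits cannot agree for ever. *)
Lemma digits_differ x y (s t : nat -> R) k k' : 1 < x -> x < y ->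
  s 0%N = 1 -> t 0%N = 1 ->
  (forall i, s i.+1 = x * s i - (k i)%:~R) ->
  (forall i, t i.+1 = y * t i - (k' i)%:~R) ->
  (forall i, 0 <= s i) -> (forall i, t i <= 1) ->
  exists n, k n != k' n /\ forall i, (i < n)%N -> k i = k' i.
Proof.
move=> x1 xy s0 t0 sS tS s_ge0 t_le1.
have y1 := lt_trans x1 xy.
have ex : exists n, k n != k' n.
  apply: contrapT => /forallNP h.
  have kk i : k i = k' i by apply/eqP/negPn/negP; exact: h.
  have [n hn] := @archi_expr y (y - x)^-1 y1.
  have yx : 0 < y - x by rewrite subr_gt0.
  have tS' i : t i.+1 = y * t i - (k i)%:~R by rewrite kk.
  have := @expansion_gap_ge x y s t k n.+1 (ltW x1) (ltW xy) s0 t0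
    (fun i _ => sS i) (fun i _ => tS' i) (fun i _ => s_ge0 i) n (leqnn _).
  have := t_le1 n.+1; have := s_ge0 n.+1.
  by move: hn; rewrite -[_^-1]mul1r ltr_pdivrMr //; lra.
exists (ex_minn ex); case: ex_minnP => n hn hmin; split=> // i i_n.
by apply/eqP/negPn/negP => /hmin; rewrite leqNgt i_n.
Qed.

(** ** The quasi-greedy expansion *)

(** The ceiling chooses the digit so that the orbit stays in (0, 1]: this is
    the expansion of 1 seen from below, the limit of the expansions of x as x
    increases to 1. *)
Fixpoint qorbit b n : R :=
  if n is n'.+1 then
    b * qorbit b n' - (Num.ceil (b * qorbit b n') - 1)%:~R
  else 1.

Definition qdigit b n : int := Num.ceil (b * qorbit b n) - 1.
Definition cqdigit b n : R[i] := ((qdigit b n)%:~R : R)%:C.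

Lemma qorbitS b n : qorbit b n.+1 = b * qorbit b n - (qdigit b n)%:~R.
Proof. by []. Qed.

Lemma qorbit_itv b n : 0 < qorbit b n <= 1.
Proof.
case: n => [|n]; first by rewrite ltr01 lexx.
have /andP[] := ceil_itv (b * qorbit b n).
by rewrite qorbitS /qdigit intrB; lra.
Qed.

Lemma qdigit_ge0 b n : 0 < b -> 0 <= qdigit b n.
Proof.
move=> b0; have /andP[q0 _] := qorbit_itv b n.
rewrite subr_ge0 -gtz0_ge1 ceil_gt0 //.
by rewrite mulr_gt0.
Qed.

Lemma qdigit_le b n : 0 < b -> (qdigit b n)%:~R <= b.
Proof.
move=> b0; have /andP[_ q1] := qorbit_itv b n.
have /andP[q0 _] := qorbit_itv b n.+1; have := qorbitS b n.
have : b * qorbit b n <= b by rewrite ger_pMr.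
by lra.
Qed.

Lemma cqdigit_linf b : 0 < b -> linf_le (cqdigit b) b.
Proof.
move=> b0 n; rewrite normc_real ger0_norm ?qdigit_le //.
by rewrite ler0z qdigit_ge0.
Qed.

(** If all later digits were 0 the orbit would grow by the factor b for ever. *)
Lemma qorbit_large b N : 1 < b -> exists2 n, (N <= n)%N & 1 < b * qorbit b n.
Proof.
move=> b1; apply: contrapT => h.
have hle n : (N <= n)%N -> b * qorbit b n <= 1.
  by move=> Nn; rewrite leNgt; apply/negP => hn; apply: h; exists n.
have b0 : 0 < b by apply: lt_trans b1.
have hq n : (N <= n)%N -> qdigit b n = 0.
  move=> /hle hn; have /andP[q0 _] := qorbit_itv b n; rewrite /qdigit.
  rewrite (@ceil_def _ _ 1) ?subrr //.
  by rewrite hn andbT mulr_gt0.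
have hE j : qorbit b (N + j) = b ^+ j * qorbit b N.
  elim: j => [|j IH]; first by rewrite addn0 mul1r.
  by rewrite addnS qorbitS hq ?leq_addr // subr0 IH exprS mulrA.
have /andP[q0 _] := qorbit_itv b N.
have [j hj] := @archi_expr b (qorbit b N)^-1 b1.
have /andP[_] := qorbit_itv b (N + j); rewrite hE leNgt => /negP[].
by move: hj; rewrite -[_^-1]mul1r ltr_pdivrMr.
Qed.

(** Just below 1 the n-th iterate of tau is affine with slope b^n. *)
Lemma iter_tau_left b n : 1 < b -> exists2 z, z < 1 & forall x, z < x ->
  x < 1 -> iter n (tau b) x = qorbit b n - b ^+ n * (1 - x).
Proof.
move=> b1; have b0 : 0 < b by apply: lt_trans b1.
elim: n => [|n [z z1 hz]].
  by exists 0 => [|x _ _]; [exact: ltr01|rewrite mul1r /=; lra].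
have /andP[q0 q1] := qorbit_itv b n.+1.
have bn : 0 < b ^+ n.+1 by rewrite exprn_gt0.
exists (Num.max z (1 - qorbit b n.+1 / b ^+ n.+1)).
  by rewrite gt_max z1 gtrBl divr_gt0.
move=> x; rewrite gt_max ltrBlDl -ltrBlDr => /andP[zx hx] x1.
rewrite [LHS]/= hz // /tau.
have hx' : b ^+ n.+1 * (1 - x) < qorbit b n.+1.
  by move: hx; rewrite ltr_pdivlMr // mulrC.
have hx0 : 0 < b ^+ n.+1 * (1 - x) by rewrite mulr_gt0 // subr_gt0.
have E : b * (qorbit b n - b ^+ n * (1 - x)) =
    (qdigit b n)%:~R + (qorbit b n.+1 - b ^+ n.+1 * (1 - x)).
  by rewrite qorbitS exprS; ring.
rewrite (@floor_def _ _ (qdigit b n)) E.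
  by ring.
by rewrite intrD; apply/andP; split; lra.
Qed.

Lemma lim_iter_tau b n : 1 < b ->
  lim (iter n (tau b) x @[x --> (1 : R)^'-]) = qorbit b n.
Proof.
move=> b1; apply: cvg_lim => //; have [z z1 hz] := iter_tau_left n b1.
have bn : 0 < b ^+ n by rewrite exprn_gt0 // (lt_trans ltr01).
apply/cvgrPdist_lt => e e0; near=> x.
have x1 : x < 1 by [].
have zx : z < x by near: x; exact: nbhs_left_gt.
rewrite hz //.
rewrite opprB addrC subrK ger0_norm; last by rewrite mulr_ge0 ?subr_ge0 ?ltW.
rewrite mulrC -ltr_pdivlMr // ltrBlDl -ltrBlDr.
by near: x; apply: nbhs_left_gt; rewrite gtrBl divr_gt0.
Unshelve. all: by end_near.
Qed.

Definition qkneading b w : R[i] := 1 - w * ps (cqdigit b) w.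

Lemma qorbit_before b p : 1 < b ->
  (forall i, (i < p)%N -> orbit1 b i != 0) ->
  (forall i, (i < p)%N -> qorbit b i = orbit1 b i) /\
  (forall i, (i.+1 < p)%N -> qdigit b i = digit b i).
Proof.
move=> b1 hp.
have dg i : (i.+1 < p)%N -> qorbit b i = orbit1 b i -> qdigit b i = digit b i.
  move=> ip E; rewrite /qdigit E; apply/eqP; rewrite subr_eq; apply/eqP.
  have /andP[h1 h2] := floor_itv (b * orbit1 b i).
  apply: ceil_def; rewrite addrK (ltW h2) andbT lt_neqAle h1 andbT.
  by have := hp _ ip; rewrite orbit1S subr_eq0 eq_sym.
have oq i : (i < p)%N -> qorbit b i = orbit1 b i.
  elim: i => [//|i IH] ip; have E := IH (ltnW ip).
  by rewrite qorbitS orbit1S E dg.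
by split=> // i ip; apply: dg => //; apply: oq; exact: ltnW.
Qed.

(** If the greedy orbit never hits 0 the two expansions coincide; if it first
    hits 0 at time p, the quasi-greedy one is p-periodic and the kneading
    series differ by the factor 1 - w^p. *)
Lemma kneading_qkneading b w : 1 < b -> normc w < 1 -> exists th : R[i],
  [/\ kneading b w = th * qkneading b w, 1 - normc w <= normc th &
      normc th <= 2].
Proof.
move=> b1 w1; have b0 : 0 < b by apply: lt_trans b1.
have [[p0 hp0]|hN] := pselect (exists p, orbit1 b p == 0); last first.
  exists 1; rewrite mul1r normc1; split; last by lra.
    rewrite /kneading /qkneading; congr (1 - _ * ps _ _); apply/funext => n.
    have hne i : (i < n.+2)%N -> orbit1 b i != 0.
      by move=> _; apply/negP => h; apply: hN; exists i.
    by rewrite /cdigit /cqdigit (qorbit_before b1 hne).2.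
  by rewrite gerBl normc_ge0.
have [[|p] hp pmin] := ex_minnP (ex_intro (fun p => orbit1 b p == 0) p0 hp0).
  by rewrite oner_eq0 in hp.
have hne i : (i < p.+1)%N -> orbit1 b i != 0.
  by move=> ip; apply/negP => /pmin; rewrite leqNgt ip.
have [oq dq] := qorbit_before b1 hne.
have dp : qdigit b p = digit b p - 1.
  rewrite /qdigit /digit oq //; congr (_ - 1); apply: ceil_def.
  move: hp; rewrite orbit1S subr_eq0 => /eqP E.
  by rewrite -/(digit b p) intrB; apply/andP; split; lra.
have qp : qorbit b p.+1 = 1.
  move: hp; rewrite qorbitS orbit1S oq // dp intrB => /eqP; lra.
have hper i : qorbit b (p.+1 + i) = qorbit b i.
  elim: i => [|i IH]; first by rewrite addn0 qp.
  by rewrite addnS (qorbitS b (p.+1 + i)) (qorbitS b i) /qdigit IH.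
have d0 n : (p.+1 <= n)%N -> cdigit b n = 0.
  move=> pn; suff E : orbit1 b n = 0 by rewrite /cdigit /digit E mulr0 floor0.
  rewrite -(subnKC pn); elim: (n - p.+1)%N => [|j IH].
    by rewrite addn0; exact/eqP.
  by rewrite addnS orbit1S IH mulr0 /digit IH mulr0 floor0 subrr.
have Ed : ps (cdigit b) w = \sum_(i < p) w ^+ i * cqdigit b i +
    w ^+ p * (cqdigit b p + 1).
  rewrite (ps_finite w d0) big_ord_recr /=; congr (_ + _).
    by apply: eq_bigr => i _; rewrite /cdigit /cqdigit dq // ltnS.
  rewrite /cdigit /cqdigit dp intrB (rmorphB (@real_complex R)) /=.
  by rewrite (rmorph1 (@real_complex R)) subrK.
have Eq : ps (cqdigit b) w = \sum_(i < p) w ^+ i * cqdigit b i +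
    w ^+ p * cqdigit b p + w ^+ p.+1 * ps (cqdigit b) w.
  rewrite {1}(ps_drop p.+1 (cqdigit_linf b0) w1) big_ord_recr /=.
  congr (_ + _ * ps _ _); apply/funext => i.
  by rewrite /cqdigit /qdigit hper.
exists (1 - w ^+ p.+1); split.
- rewrite /kneading /qkneading Ed.
  have -> : \sum_(i < p) w ^+ i * cqdigit b i =
      (1 - w ^+ p.+1) * ps (cqdigit b) w - w ^+ p * cqdigit b p.
    by rewrite mulrBl mul1r {1}Eq; ring.
  by rewrite exprS; ring.
- have := normc_rtriangle 1 (1 - w ^+ p.+1).
  rewrite subKr normc1 normcX => h.
  have : normc w ^+ p.+1 <= normc w.
    by rewrite exprS ler_piMr ?normc_ge0 // exprn_ile1 ?normc_ge0 // ltW.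
  by lra.
- apply: le_trans (normcB_le _ _) _; rewrite normc1 normcX.
  have : normc w ^+ p.+1 <= 1 by rewrite exprn_ile1 ?normc_ge0 // ltW.
  by lra.
Qed.

(** ** First difference of digits *)

(** The larger base reaches the next integer first, so the gap before taking
    the digit is at least the distance 1 - T_(n+1) of the smaller one to it. *)
Lemma first_diff_right b0 b : 1 < b0 -> b0 < b -> exists n,
  (forall i, (i < n)%N -> digit b i = digit b0 i) /\
  1 - orbit1 b0 n.+1 <= (b - b0) * (b ^+ n.+1 / (b - 1)).
Proof.
move=> b01 bb; have b1 := lt_trans b01 bb.
have s_itv i : 0 <= orbit1 b0 i <= 1 by exact: orbit1_itv.
have t_itv i : 0 <= orbit1 b i <= 1 by exact: orbit1_itv.
have [|i|n [hn hlt]] := @digits_differ b0 b (orbit1 b0) (orbit1 b) (digit b0)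
  (digit b) b01 bb erefl erefl (orbit1S b0) (orbit1S b).
- by move=> i; case/andP: (s_itv i).
- by case/andP: (t_itv i).
exists n; split=> [i i_n|]; first by rewrite hlt.
have sS i (_ : (i < n)%N) := orbit1S b0 i.
have tS i (i_n : (i < n)%N) : orbit1 b i.+1 = b * orbit1 b i - (digit b0 i)%:~R.
  by rewrite orbit1S hlt.
have s0 i (_ : (i < n)%N) : 0 <= orbit1 b0 i by case/andP: (s_itv i).
have s1 i (_ : (i <= n)%N) : orbit1 b0 i <= 1 by case/andP: (s_itv i).
apply: le_trans _ (@expansion_next_gap b0 b (orbit1 b0) (orbit1 b) (digit b0) n
  (ltW b01) (ltW bb) erefl erefl sS tS b1 s1).
have hmono := @expansion_mono b0 b (orbit1 b0) (orbit1 b) (digit b0) n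
  (ltW b01) (ltW bb) erefl erefl sS tS s0 n (leqnn n).
have hle : b0 * orbit1 b0 n <= b * orbit1 b n.
  apply: ler_pM => //; last exact: ltW.
    by apply: ltW; apply: lt_trans b01.
  by case/andP: (s_itv n).
have : digit b0 n < digit b n by rewrite lt_neqAle hn le_floor.
rewrite -lezD1 -(ler_int R) intrD => h.
have := floor_le (b * orbit1 b n); rewrite -/(digit b n) => h'.
by have := orbit1S b0 n; lra.
Qed.

(** Here the quasi-greedy orbit of the larger base has already passed the
    integer, by q_(n+1), that the smaller base does not reach. *)
Lemma first_diff_left b0 b : 1 < b -> b < b0 -> exists n,
  (forall i, (i < n)%N -> digit b i = qdigit b0 i) /\
  qorbit b0 n.+1 <= (b0 - b) * (b0 ^+ n.+1 / (b0 - 1)).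
Proof.
move=> b1 bb; have b01 := lt_trans b1 bb.
have s_itv i : 0 <= orbit1 b i <= 1 by exact: orbit1_itv.
have t_itv i : 0 < qorbit b0 i <= 1 by exact: qorbit_itv.
have [|i|n [hn hlt]] := @digits_differ b b0 (orbit1 b) (qorbit b0) (digit b)
  (qdigit b0) b1 bb erefl erefl (orbit1S b) (qorbitS b0).
- by move=> i; case/andP: (s_itv i).
- by case/andP: (t_itv i).
exists n; split=> [i i_n|]; first exact: hlt.
have sS i (_ : (i < n)%N) := orbit1S b i.
have tS i (i_n : (i < n)%N) :
    qorbit b0 i.+1 = b0 * qorbit b0 i - (digit b i)%:~R.
  by rewrite qorbitS hlt.
have s0 i (_ : (i < n)%N) : 0 <= orbit1 b i by case/andP: (s_itv i).
have s1 i (_ : (i <= n)%N) : orbit1 b i <= 1 by case/andP: (s_itv i).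
apply: le_trans _ (@expansion_next_gap b b0 (orbit1 b) (qorbit b0) (digit b) n
  (ltW b1) (ltW bb) erefl erefl sS tS b01 s1).
have hmono := @expansion_mono b b0 (orbit1 b) (qorbit b0) (digit b) n
  (ltW b1) (ltW bb) erefl erefl sS tS s0 n (leqnn n).
have hlt' : b * orbit1 b n < b0 * qorbit b0 n.
  have /andP[q0 _] := t_itv n; apply: (@le_lt_trans _ _ (b * qorbit b0 n)).
    by rewrite ler_wpM2l // ltW // (lt_trans ltr01).
  by rewrite ltr_pM2r.
have /andP[_ q1] := t_itv n.+1.
have hq := qorbitS b0 n.
have : digit b n < qdigit b0 n.
  rewrite lt_neqAle hn /= -ltzD1 floor_lt_int intrD.
  by apply: lt_le_trans hlt' _; lra.
by rewrite floor_lt_int; lra.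
Qed.

(** ** Nearby bases with finite expansions *)

Lemma affine_orbit_continuous k n :
  continuous (fun y : R => affine_orbit k y n).
Proof.
elim: n => [|n IH] y /=; first exact: cvg_cst.
by apply: cvgB; [apply: cvgM; [exact: cvg_id|exact: IH]|exact: cvg_cst].
Qed.

Lemma affine_orbit_q b n : affine_orbit (qdigit b) b n = qorbit b n.
Proof. by elim: n => //= n ->. Qed.

(** Products and shifts of functions of the base that are non-negative and
    increasing are increasing. *)
Lemma affine_orbit_mono b n x y z : 1 <= z -> z <= x -> x <= y -> y <= b ->
  (forall i, (i <= n)%N -> forall v, z <= v -> v <= b ->
     0 <= affine_orbit (qdigit b) v i) ->
  forall i, (i <= n.+1)%N ->
  affine_orbit (qdigit b) x i <= affine_orbit (qdigit b) y i.
Proof.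
move=> z1 zx xy yb h i i_n.
apply: (@expansion_mono x y _ _ (qdigit b) n.+1 (le_trans z1 zx) xy) => //.
by move=> j jn; apply: h => //; exact: le_trans xy yb.
Qed.

(** Going down from b, the polynomials [affine_orbit (qdigit b) _ n] vanish one
    after the other, each before the previous one does. *)
Lemma affine_orbit_root b n : 1 < b -> exists z, [/\ 1 <= z, z < b,
  affine_orbit (qdigit b) z n.+1 = 0 &
  forall i, (i <= n.+1)%N -> forall v, z <= v -> v <= b ->
    0 <= affine_orbit (qdigit b) v i].
Proof.
move=> b1; have b0 : 0 < b by apply: lt_trans b1.
elim: n => [|n [z [z1 zb hz hpos]]].
  exists (qdigit b 0)%:~R; have q0 : qorbit b 1 = b - (qdigit b 0)%:~R by rewrite qorbitS mulr1.
  have /andP[q1 _] := qorbit_itv b 1.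
  split.
  - by rewrite ler1z /qdigit mulr1 lerBrDr lezD1 ceil_gt_int.
  - by lra.
  - by rewrite /= mulr1 subrr.
  - by case=> [|[|//]] _ v hv _ /=; rewrite ?ler01 // mulr1 subr_ge0.
have mono x y : z <= x -> x <= y -> y <= b ->
    affine_orbit (qdigit b) x n.+2 <= affine_orbit (qdigit b) y n.+2.
  by move=> zx xy yb; apply: (@affine_orbit_mono b n.+1 x y z).
have hb : 0 < affine_orbit (qdigit b) b n.+2.
  by rewrite affine_orbit_q; case/andP: (qorbit_itv b n.+2).
have hz' : affine_orbit (qdigit b) z n.+2 <= 0.
  by rewrite /= -/(affine_orbit (qdigit b) z n.+1) hz mulr0 sub0r oppr_le0
    ler0z qdigit_ge0.
have [||x xin hx] := @IVT R (fun y => affine_orbit (qdigit b) y n.+2) z b 0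
  (ltW zb).
- apply: continuous_subspaceT => y; exact: affine_orbit_continuous.
- by rewrite ge_min hz' le_max (ltW hb) orbT.
move: xin; rewrite in_itv /= => /andP[zx xb].
exists x; split=> //.
- exact: le_trans z1 zx.
- rewrite lt_neqAle xb andbT; apply/eqP => E.
  by move: hb; rewrite -{2}E hx ltxx.
- move=> i; rewrite leq_eqVlt => /orP[/eqP->|i_n] v xv vb.
    by rewrite -hx; exact: mono.
  by apply: hpos => //; exact: le_trans zx xv.
Qed.

Lemma orbit1_affine k b N :
  (forall i, (i < N)%N -> 0 <= affine_orbit k b i.+1 < 1) ->
  (forall i, (i <= N)%N -> orbit1 b i = affine_orbit k b i) /\
  (forall i, (i < N)%N -> digit b i = k i).
Proof.
move=> h.
have dg i : (i < N)%N -> orbit1 b i = affine_orbit k b i -> digit b i = k i.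
  move=> iN E; have /= := h i iN; rewrite /digit E => /andP[h1 h2].
  by apply: floor_def; rewrite intrD; apply/andP; split; lra.
have oq i : (i <= N)%N -> orbit1 b i = affine_orbit k b i.
  elim: i => [//|i IH] iN; have E := IH (ltnW iN).
  by rewrite orbit1S E dg.
by split=> // i iN; apply: dg => //; apply: oq; exact: ltnW.
Qed.

(** For infinitely many N there are two bases exponentially close to b whose
    expansions of 1 follow that of b up to time N and then stop, one at once
    and one after a single digit 1. *)
Lemma finite_expansions b n : 1 < b -> 1 < b * qorbit b n.+1 ->
  exists x y, [/\ [/\ x < b, 1 <= x & b ^+ n * (b - x) <= 1],
    [/\ y < b, 1 <= y & b ^+ n * (b - y) <= 1],
    forall i, (i < n.+1)%N -> digit x i = qdigit b i /\ digit y i = qdigit b i &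
    forall i, digit x (n.+1 + i) = 0 /\ digit y (n.+1 + i) = (i == 0)%N%:Z].
Proof.
move=> b1 hbig; have b0 : 0 < b by apply: lt_trans b1.
have [x [x1 xb hx hpos]] := affine_orbit_root n b1.
set P := affine_orbit (qdigit b) in hx hpos.
have Pq i : P b i = qorbit b i by exact: affine_orbit_q.
have [||y yin hy] := @IVT R (fun y => y * P y n.+1) x b 1 (ltW xb).
- apply: continuous_subspaceT => y; apply: cvgM; first exact: cvg_id.
  exact: affine_orbit_continuous.
- by rewrite hx mulr0 ge_min ler01 le_max Pq (ltW hbig) orbT.
move: yin; rewrite in_itv /= => /andP[xy yb].
have {}yb : y < b.
  rewrite lt_neqAle yb andbT; apply/eqP => E.
  by move: hbig; rewrite -Pq -E hy ltxx.
have gap v : x <= v -> v < b -> forall i, (i < n.+1)%N ->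
    b ^+ i * (b - v) <= qorbit b i.+1 - P v i.+1.
  move=> xv vb i i_n; rewrite -Pq.
  apply: (@expansion_gap_ge v b (P v) (P b) (qdigit b) n.+1) => //.
  - exact: le_trans x1 xv.
  - exact: ltW.
  - by move=> j jn; apply: hpos => //; [exact: ltnW|exact: ltW].
have itv v : x <= v -> v < b -> forall i, (i < n.+1)%N -> 0 <= P v i.+1 < 1.
  move=> xv vb i i_n; rewrite hpos ?(ltW vb) //=.
  have := gap v xv vb i i_n; have /andP[_ q1] := qorbit_itv b i.+1.
  have : 0 < b ^+ i * (b - v) by rewrite mulr_gt0 ?exprn_gt0 // subr_gt0.
  by lra.
have near v : x <= v -> v < b -> b ^+ n * (b - v) <= 1.
  move=> xv vb; have := gap v xv vb n (leqnn _).
  have /andP[_ q1] := qorbit_itv b n.+1; have /andP[p0 _] := itv v xv vb n (leqnn _).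
  by lra.
have [ox dx] := orbit1_affine (itv x (lexx x) xb).
have [oy dy] := orbit1_affine (itv y xy yb).
have stop v m : orbit1 v m = 0 -> forall i, orbit1 v (m + i) = 0.
  move=> h0; elim=> [|i IH]; first by rewrite addn0.
  by rewrite addnS orbit1S /digit IH mulr0 floor0 subrr.
have dy0 : digit y n.+1 = 1.
  by rewrite /digit oy // -/P hy floor1.
exists x, y; split.
- by split=> //; exact: near.
- by split=> //; [exact: le_trans x1 xy|exact: near].
- by move=> i i_n; split; [exact: dx|exact: dy].
- move=> i; split.
    by rewrite /digit stop ?mulr0 ?floor0 // ox // -/P hx.
  case: i => [|i]; first by rewrite addn0 dy0.
  rewrite addnS -addSn /digit stop ?mulr0 ?floor0 //.
  by rewrite orbit1S dy0 oy // -/P hy subrr.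
Qed.

End Expansions.

(** * Regularity of the eigenvalue *)

Section RootGrowth.
Variable R : realType.
Variable u : nat -> R.
Hypothesis u_itv : forall n, 0 <= u n <= 1.

Let v n := u n `^ (n%:R^-1).

Let v_itv n : 0 <= v n <= 1.
Proof.
have /andP[u0 u1] := u_itv n; have <- : 1 `^ (n%:R^-1) = 1 :> R by rewrite powR1.
rewrite powR_ge0 /=.
by apply: ge0_ler_powR; rewrite ?nnegrE ?invr_ge0.
Qed.

Let limn_infE_v : limn_inf v = sup (range (infs v)).
Proof.
apply: limn_infE; exists 1; split; first exact: num_real.
move=> A A1 n _ /=; have /andP[v0 v1] := v_itv n.
by rewrite ger0_norm // (le_trans v1) // ltW.
Qed.

Let infs_le n k : (n <= k)%N -> infs v n <= v k.
Proof.
move=> nk; apply: ge_inf; last by exists k.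
by exists 0 => _ [j _ <-]; case/andP: (v_itv j).
Qed.

Lemma limn_inf_root_le1 : limn_inf v <= 1.
Proof.
rewrite limn_infE_v; apply: ge_sup => [|_ [n _ <-]]; first by exists (infs v 0), 0%N.
by apply: le_trans (infs_le (leqnn n)) _; case/andP: (v_itv n).
Qed.

(** The finitely many initial terms are absorbed by the constant. *)
Lemma limn_inf_root_gt g : (forall n, 0 < u n.+1) -> 0 < g -> g < limn_inf v ->
  exists2 c, 0 < c & forall n, c * g ^+ n.+1 <= u n.+1.
Proof.
move=> upos g0; rewrite limn_infE_v => gv.
have g1 : g <= 1.
  by apply: ltW; apply: lt_le_trans gv _; rewrite -limn_infE_v limn_inf_root_le1.
have ne : range (infs v) !=set0 by exists (infs v 0), 0%N.
have [_ [N _ <-] hN] := sup_gt ne gv.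
have large n : (N <= n.+1)%N -> g ^+ n.+1 <= u n.+1.
  move=> Nn; have h := ltW (lt_le_trans hN (infs_le Nn)).
  have /andP[u0 _] := u_itv n.+1.
  have -> : u n.+1 = v n.+1 ^+ n.+1.
    by rewrite -powR_mulrn ?powR_ge0 // -powRrM mulVf // powRr1.
  by rewrite lerXn2r ?nnegrE ?powR_ge0 // ltW.
have [c c0 hc] : exists2 c, 0 < c & forall n, (n < N)%N -> c <= u n.+1.
  elim: N {hN large} => [|N [c c0 hc]]; first by exists 1.
  exists (Num.min c (u N.+1)); first by rewrite lt_min c0 upos.
  move=> n; rewrite ltnS leq_eqVlt => /orP[/eqP->|/hc h].
    by rewrite ge_min lexx orbT.
  by rewrite ge_min h.
exists (Num.min c 1); first by rewrite lt_min c0 ltr01.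
move=> n; have gn : 0 <= g ^+ n.+1 by rewrite exprn_ge0 // ltW.
have [nN|Nn] := ltnP n N.
  apply: le_trans (hc _ nN); rewrite -[leRHS]mulr1.
  apply: ler_pM => //; first by rewrite le_min (ltW c0) ler01.
    by rewrite ge_min lexx.
  by rewrite exprn_ile1 // ltW.
apply: le_trans (large n (leqW Nn)).
by rewrite ler_piMl // ge_min lexx orbT.
Qed.

End RootGrowth.

Section Perturbation.
Variable R : realType.

Lemma ps_agree (c c' : nat -> R[i]) (B B' : R) n (w : R[i]) :
  linf_le c B -> linf_le c' B' -> normc w < 1 ->
  (forall i, (i < n)%N -> c i = c' i) ->
  ps c w - ps c' w = w ^+ n * ps (fun i => c (n + i)%N - c' (n + i)%N) w.
Proof.
move=> hB hB' w1 E.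
rewrite (ps_drop n hB w1) (ps_drop n hB' w1).
rewrite (psB (linf_le_drop n hB) (linf_le_drop n hB') w1).
rewrite (eq_bigr (fun i : 'I_n => w ^+ i * c' i)) => [|i _]; last by rewrite E.
by rewrite opprD addrACA subrr add0r -mulrBr.
Qed.

Lemma linf_leB (c c' : nat -> R[i]) (B B' : R) : linf_le c B -> linf_le c' B' ->
  linf_le (fun i => c i - c' i) (B + B').
Proof. by move=> h h' i; apply: le_trans (normcB_le _ _) _; rewrite lerD. Qed.

Lemma powR_expR (x y : R) : expR x `^ y = expR (y * x).
Proof. by rewrite /powR gt_eqF ?expR_gt0 // expRK. Qed.

Lemma le_powR_self (x a : R) : 0 <= x -> x <= 1 -> 0 <= a -> a <= 1 -> x <= x `^ a.
Proof.
move=> x0 x1 a0 a1; move: x0; rewrite le_eqVlt => /orP[/eqP <-|x0].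
  exact: powR_ge0.
rewrite -[leLHS](powRr1 (ltW x0)); apply: ger_powR => //.
by rewrite x0 x1.
Qed.

Variables (b0 : R) (M : nat) (U : set R) (lam : R -> R[i]^o).
Hypotheses (b0_gt1 : 1 < b0) (M_ge1 : (1 <= M)%N)
  (lam0_mult : eigenvalue_multiplicity b0 (lam b0) M)
  (U_open : open U) (U_b0 : U b0) (U_gt1 : forall b, U b -> 1 < b)
  (lam_cont : {for b0, continuous lam})
  (lam_eig : forall b, U b -> nonleading_eigenvalue b (lam b)).

Let zero b := recip b (lam b).

Lemma lam_gt b : U b -> b^-1 < normc (lam b).
Proof. by move=> /lam_eig[]. Qed.

Lemma zero_lt1 b : U b -> normc (zero b) < 1.
Proof. by move=> Ub; apply: normc_recip_lt1; [exact: U_gt1|exact: lam_gt]. Qed.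

Lemma kneading_zero b : U b -> kneading b (zero b) = 0.
Proof.
move=> Ub; have [h hb _] := lam_eig Ub; have b1 := U_gt1 Ub.
exact: (defect0_kneading b1 hb (eigenvalue_defect0 b1 hb h)).
Qed.

Lemma lam_lt1 b : U b -> normc (lam b) < 1.
Proof.
move=> Ub; have [h hb l1] := lam_eig Ub.
exact: eigenvalue_lt1 (U_gt1 Ub) hb (kneading_zero Ub) l1.
Qed.

Lemma lam_zero b : U b -> b%:C * lam b * zero b = 1.
Proof.
move=> Ub; rewrite mulfV // mulf_neq0 //; rewrite -normc_gt0.
  by rewrite normc_real normr_gt0 gt_eqF // (lt_trans ltr01) // U_gt1.
by apply: lt_trans (lam_gt Ub); rewrite invr_gt0 (lt_trans ltr01) // U_gt1.
Qed.

Let scaled_gap b (x y : R[i]) : U b -> normc y <= 1 ->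
  normc (b%:C * x - b0%:C * y) <= b * normc (x - y) + `|b - b0|.
Proof.
move=> Ub y1; have b_0 : 0 < b by apply: lt_trans (U_gt1 Ub).
rewrite (_ : _ - _ = b%:C * (x - y) + (b - b0)%:C * y); last first.
  by rewrite (rmorphB (@real_complex R)) /=; ring.
apply: le_trans (normcD_le _ _) _; rewrite !normcM !normc_real gtr0_norm //.
by rewrite lerD2l ler_piMr.
Qed.

(** Passing between l and w = 1/(b l) costs a Lipschitz error in b, which is
    harmless for exponents at most 1. *)
Lemma lam_gap b : U b ->
  normc (lam b - lam b0) <= b * normc (zero b - zero b0) + `|b - b0|.
Proof.
move=> Ub; have z := lam_zero Ub; have z0 := lam_zero U_b0.
have -> : lam b - lam b0 =
    - (lam b * lam b0 * (b%:C * zero b - b0%:C * zero b0)).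
  rewrite mulrBr opprB.
  transitivity (lam b * (b0%:C * lam b0 * zero b0) -
    lam b0 * (b%:C * lam b * zero b)); first by rewrite z z0 !mulr1.
  by ring.
rewrite normc_opp normcM.
apply: le_trans (scaled_gap (zero b) Ub (ltW (zero_lt1 U_b0))).
rewrite ler_piMl ?normc_ge0 // normcM.
by rewrite mulr_ile1 ?normc_ge0 // ltW // lam_lt1.
Qed.

Lemma zero_gap b : U b ->
  normc (zero b - zero b0) <= b * normc (lam b - lam b0) + `|b - b0|.
Proof.
move=> Ub; have z := lam_zero Ub; have z0 := lam_zero U_b0.
have -> : zero b - zero b0 =
    - (zero b * zero b0 * (b%:C * lam b - b0%:C * lam b0)).
  rewrite mulrBr opprB.
  transitivity (zero b * (b0%:C * lam b0 * zero b0) -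
    zero b0 * (b%:C * lam b * zero b)); first by rewrite z z0 !mulr1.
  by ring.
rewrite normc_opp normcM.
apply: le_trans (scaled_gap (lam b) Ub (ltW (lam_lt1 U_b0))).
rewrite ler_piMl ?normc_ge0 // normcM.
by rewrite mulr_ile1 ?normc_ge0 // ltW // zero_lt1.
Qed.

Lemma lam_near e : 0 < e -> exists2 d, 0 < d & forall b, `|b - b0| < d ->
  normc (lam b - lam b0) < e.
Proof.
move=> e0; have eC : 0 < e%:C :> R[i] by rewrite ltcR.
have /cvgrPdist_lt /(_ _ eC) /nbhs_ballP[d /= d0 hd] := lam_cont.
exists d => // b hb; have : ball b0 d b by rewrite /ball /= distrC.
move=> /hd /=; rewrite normc_distC.
by rewrite -[`|_|]/((normc (lam b0 - lam b))%:C) ltcR.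
Qed.

Lemma U_near : exists2 d, 0 < d & forall b, `|b - b0| < d -> U b.
Proof.
have /nbhs_ballP[d /= d0 hd] : nbhs b0 U by apply: open_nbhs_nbhs; split.
by exists d => // b hb; apply: hd; rewrite /ball /= distrC.
Qed.

Lemma zero_near e : 0 < e -> exists2 d, 0 < d & forall b, `|b - b0| < d ->
  [/\ U b, `|b - b0| < e & normc (zero b - zero b0) < e].
Proof.
move=> e0; have [d1 d10 h1] := U_near.
have b00 : 0 < b0 by apply: lt_trans b0_gt1.
pose e' : R := e / (2 * (b0 + 1)).
have e'0 : 0 < e' by rewrite divr_gt0 // mulr_gt0 // ltr_wpDl // ltW.
have [d2 d20 h2] := lam_near e'0.
exists (Num.min (Num.min d1 d2) (Num.min 1 (e / 2))).
  by rewrite !lt_min d10 d20 ltr01 divr_gt0.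
move=> b; rewrite !lt_min => /andP[/andP[hb1 hb2] /andP[hb3 hb4]].
have Ub := h1 _ hb1; split=> //; first by lra.
apply: le_lt_trans (zero_gap Ub) _.
have bb : b <= b0 + 1 by move: hb3; rewrite ltr_distlC; lra.
have : b * normc (lam b - lam b0) <= (b0 + 1) * e'.
  by apply: ler_pM; rewrite ?normc_ge0 ?(ltW (h2 _ hb2)) // ltW // (lt_trans ltr01) // U_gt1.
have -> : (b0 + 1) * e' = e / 2 by rewrite /e'; field; rewrite gt_eqF; lra.
by lra.
Qed.

Let order := multiplicity_defect b0_gt1 (lam_gt U_b0) lam0_mult.

Lemma kneading_order0 : exists C d : R, [/\ 0 < C, 0 < d &
  forall w, normc (w - zero b0) < d ->
    [/\ normc (w - zero b0) ^+ M <= C * normc (kneading b0 w),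
        normc (kneading b0 w) <= C * normc (w - zero b0) ^+ M & normc w < 1]].
Proof. by case: order => h1 h2; have := kneading_order b0_gt1 (lam_gt U_b0) M_ge1 h1 h2. Qed.

Let Lam := ln (normc (b0%:C * lam b0)).

Let b0_pos : 0 < b0. Proof. exact: lt_trans b0_gt1. Qed.

Lemma b0lam0_gt1 : 1 < normc (b0%:C * lam b0).
Proof.
rewrite normcM normc_real gtr0_norm // mulrC -ltr_pdivrMr // mul1r.
exact: lam_gt.
Qed.

Lemma normc_zero0 : normc (zero b0) = expR (- Lam).
Proof.
rewrite normcV expRN lnK // posrE; exact: lt_trans b0lam0_gt1.
Qed.

Lemma Lam_lt : Lam < ln b0.
Proof.
rewrite ltr_ln ?posrE //; last exact: lt_trans b0lam0_gt1.
by rewrite normcM normc_real gtr0_norm // gtr_pMr // lam_lt1.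
Qed.

(** Upper estimate: bases whose digits agree with a given digit sequence c up
    to time n have a zero within about |w0|^(n/M) of w0, whereas the distance
    of the bases is at least of order u_(n+1) / b^(n+1). *)
Lemma holder_of_digits (D : set R) (c : nat -> R[i]) (u : nat -> R) (gam a : R) :
  linf_le c b0 ->
  (forall w, normc w < 1 -> normc (kneading b0 w) <= 2 * normc (1 - w * ps c w)) ->
  0 < gam -> gam <= 1 ->
  (forall g, 0 < g -> g < gam ->
    exists2 k, 0 < k & forall n, k * g ^+ n.+1 <= u n.+1) ->
  (forall b, D b -> 1 < b -> exists n, (forall i, (i < n)%N -> cdigit b i = c i) /\
    u n.+1 <= `|b - b0| * (Num.max b b0 ^+ n.+1 / (b0 - 1))) ->
  0 < a -> a < M%:R^-1 * (Lam / (ln b0 + ln gam^-1)) ->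
  holder_at (U `&` D) lam b0 a.
Proof.
move=> hc hP gam0 gam1 hu hD a0 ha.
have lnb0 : 0 < ln b0 by rewrite ln_gt0.
have lng : ln gam <= 0 by rewrite ln_le0.
have M0 : 0 < M%:R :> R by rewrite ltr0n.
have M1 : 1 <= M%:R :> R by rewrite ler1n.
rewrite lnV ?posrE // in ha.
pose L := ln b0 - ln gam; have L0 : 0 < L by rewrite /L; lra.
have haL : a * M%:R * L < Lam.
  by move: ha; rewrite mulrC -/L -mulrA ltr_pdivlMr // mulrA ltr_pdivlMr.
have aM0 : 0 < a * M%:R by rewrite mulr_gt0.
have a1 : a <= 1.
  rewrite leNgt; apply/negP => a1.
  have h1 : L <= a * M%:R * L.
    by rewrite ler_peMl ?(ltW L0) // (le_trans M1) // ler_peMl ?(ltW M0) // ltW.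
  by have := Lam_lt; rewrite /L in h1 haL *; lra.
(* eps leaves room in the strict inequality a M L < Lam. *)
pose eps := (Lam - a * M%:R * L) / (1 + 2 * (a * M%:R)).
have den0 : 0 < 1 + 2 * (a * M%:R) by lra.
have eps0 : 0 < eps by rewrite divr_gt0 // subr_gt0.
have epsE : eps - Lam = a * M%:R * (- L - 2 * eps).
  by rewrite /eps; field; rewrite gt_eqF.
pose r1 := expR (eps - Lam); pose q := expR (- L - 2 * eps).
pose B1 := expR (ln b0 + eps); pose g := expR (ln gam - eps).
have qB1 : q * B1 = g by rewrite /q /B1 /g -expRD; congr expR; rewrite /L; ring.
have r1_0 : 0 < r1 by exact: expR_gt0.
have r1_1 : r1 < 1.
  rewrite /r1 -expR0 ltr_expR epsE; have : a * M%:R * (L + 2 * eps) > 0.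
    by rewrite mulr_gt0 //; lra.
  by lra.
have B1_b0 : b0 < B1.
  by rewrite -{1}(@lnK R b0) ?posrE // ltr_expR; lra.
have B1_0 : 0 < B1 by exact: expR_gt0.
have g_gam : g < gam by rewrite -(@lnK R gam) ?posrE // ltr_expR; lra.
have [k k0 hk] := hu g (expR_gt0 _) g_gam.
have w0r1 : normc (zero b0) < r1 by rewrite normc_zero0 ltr_expR; lra.
have [C [d [C0 d0 hCd]]] := kneading_order0.
pose e := Num.min (Num.min d (r1 - normc (zero b0))) (Num.min 1 (B1 - b0)).
have e0 : 0 < e by rewrite !lt_min d0 !subr_gt0 w0r1 ltr01 B1_b0.
have [d' d'0 hd'] := zero_near e0.
pose K1 := (k * (b0 - 1))^-1.
have K10 : 0 < K1 by rewrite invr_gt0 mulr_gt0 // subr_gt0.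
pose K2 := C * (2 * ((1 - r1)^-1 * (B1 + b0))).
have K20 : 0 <= K2.
  by rewrite !mulr_ge0 ?invr_ge0 ?subr_ge0 ?addr_ge0 ?(ltW C0) ?(ltW r1_1) ?(ltW B1_0) ?(ltW b0_pos).
pose K3 := Num.max 1 K2 * K1 `^ a.
have K30 : 0 <= K3 by rewrite mulr_ge0 ?powR_ge0 // le_max ler01.
exists (B1 * K3 + 1), d'; split=> //.
  by rewrite ltr_wpDl // mulr_ge0 // ltW.
move=> b [Ub Db] hb; have [_] := hd' _ hb.
rewrite !lt_min => /andP[_ /andP[hb1 hb2]] /andP[/andP[hz1 hz2] _].
have b_1 := U_gt1 Ub; have b_0 : 0 < b by apply: lt_trans b_1.
have bB1 : b <= B1.
  by have := ler_norm (b - b0); lra.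
set z := zero b in hz1 hz2; have [hz _ z1] := hCd _ hz1.
have zr1 : normc z <= r1 by have := normc_rtriangle z (zero b0); lra.
have [n [agree hn]] := hD b Db b_1.
set x := `|b - b0| in hb hb1 hb2 hn *.
have x0 : 0 <= x by exact: normr_ge0.
have hq : q ^+ n.+1 <= K1 * x.
  have h1 : k * g ^+ n.+1 <= x * (B1 ^+ n.+1 / (b0 - 1)).
    apply: le_trans (hk n) (le_trans hn _).
    rewrite ler_wpM2l // ler_wpM2r ?invr_ge0 ?subr_ge0 ?(ltW b0_gt1) //.
    rewrite lerXn2r ?nnegrE ?(ltW B1_0) //.
      by rewrite le_max (ltW b_0).
    by rewrite ge_max bB1 ltW.
  have Bn : 0 < B1 ^+ n.+1 by rewrite exprn_gt0.
  have b01 : b0 - 1 != 0 by rewrite subr_eq0 gt_eqF.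
  rewrite -qB1 exprMn in h1.
  rewrite /K1 [leRHS]mulrC ler_pdivlMr ?mulr_gt0 ?subr_gt0 //.
  rewrite -(ler_pM2r Bn).
  have b01' : 0 <= b0 - 1 by rewrite subr_ge0 ltW.
  have := ler_wpM2r b01' h1; rewrite [x * _]mulrA divfK //.
  by move: (q ^+ n.+1) (B1 ^+ n.+1) => s t; lra.
have hr1 : r1 ^+ n.+1 <= ((K1 * x) `^ a) ^+ M.
  rewrite -[leRHS]powR_mulrn ?powR_ge0 // -powRrM.
  have -> : r1 ^+ n.+1 = (q ^+ n.+1) `^ (a * M%:R).
    by rewrite /r1 /q -!expRM_natl powR_expR epsE; congr expR; ring.
  apply: ge0_ler_powR => //; first exact: ltW.
    by rewrite nnegrE exprn_ge0 // expR_ge0.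
  by rewrite nnegrE mulr_ge0 // ltW.
have hdiff : normc (1 - z * ps c z) <= r1 ^+ n.+1 * ((1 - r1)^-1 * (B1 + b0)).
  have := kneading_zero Ub; rewrite -/z /kneading => /eqP.
  rewrite subr_eq0 => /eqP E; rewrite {1}E -mulrBr.
  have hd : linf_le (cdigit b) B1.
    by move=> i; apply: le_trans (cdigit_linf b_0 i) bB1.
  rewrite (ps_agree hd hc z1 agree) mulrA -exprS normcM normcX.
  have h := ps_le (linf_leB (linf_le_drop n hd) (linf_le_drop n hc)) z1.
  apply: ler_pM; rewrite ?exprn_ge0 ?normc_ge0 //.
    by rewrite lerXn2r ?nnegrE ?normc_ge0 // ltW.
  apply: le_trans h _; rewrite ler_wpM2r //.
    by rewrite addr_ge0 // ltW.
  by rewrite lef_pV2 ?posrE ?subr_gt0 //; lra.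
have hM : normc (z - zero b0) ^+ M <= (Num.max 1 K2 * (K1 * x) `^ a) ^+ M.
  apply: (@le_trans _ _ (K2 * ((K1 * x) `^ a) ^+ M)).
    apply: le_trans hz _; rewrite /K2 -mulrA ler_wpM2l ?(ltW C0) //.
    apply: le_trans (hP _ z1) _; rewrite -mulrA ler_wpM2l //.
    apply: le_trans hdiff _; rewrite mulrC ler_wpM2l //.
    rewrite mulr_ge0 ?invr_ge0 ?subr_ge0 ?(ltW r1_1) //.
    by rewrite addr_ge0 // ltW.
  rewrite exprMn ler_wpM2r ?exprn_ge0 ?powR_ge0 //.
  apply: (@le_trans _ _ (Num.max 1 K2)); first by rewrite le_max lexx orbT.
  by rewrite ler_eXnr // le_max lexx.
have hgap : normc (z - zero b0) <= K3 * x `^ a.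
  rewrite /K3 -mulrA -powRM ?(ltW K10) //.
  rewrite -(@ler_pXn2r _ M) ?nnegrE ?normc_ge0 //.
  by rewrite mulr_ge0 ?powR_ge0 // le_max ler01.
apply: le_trans (lam_gap Ub) _; rewrite -/x -/z mulrDl mul1r lerD //.
  rewrite -mulrA; apply: ler_pM => //; rewrite ?normc_ge0 //; exact: ltW.
apply: le_powR_self => //; exact: ltW.
Qed.

Lemma geometric_small (rho A e : R) : 0 < rho -> rho < 1 -> 0 <= A -> 0 < e ->
  exists N, forall n, (N <= n)%N -> A * rho ^+ n < e.
Proof.
move=> r0 r1 A0 e0; have rV : 1 < rho^-1 by rewrite invf_gt1.
have [N hN] := @archi_expr R rho^-1 (A / e) rV.
exists N => n Nn; rewrite exprVn ltr_pdivrMr // in hN.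
rewrite ltr_pdivlMl ?exprn_gt0 // in hN.
apply: le_lt_trans hN; rewrite mulrC ler_wpM2r //.
by apply: ler_wiXn2l => //; exact: ltW.
Qed.

Lemma alpha0_itv : 0 < M%:R^-1 * (Lam / ln b0) < 1.
Proof.
have lnb0 : 0 < ln b0 by rewrite ln_gt0.
have M0 : 0 < M%:R :> R by rewrite ltr0n.
have M1 : 1 <= M%:R :> R by rewrite ler1n.
rewrite mulr_gt0 ?invr_gt0 ?divr_gt0 ?ln_gt0 ?b0lam0_gt1 //=.
rewrite mulrC ltr_pdivrMr // mul1r; apply: lt_le_trans M1.
by rewrite ltr_pdivrMr // mul1r Lam_lt.
Qed.

Lemma holder_at_weaken a a' : 0 < a' -> a' <= a ->
  holder_at U lam b0 a -> holder_at U lam b0 a'.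
Proof.
move=> a'0 aa [C [d [C0 d0 h]]]; exists C, (Num.min d 1); split=> //.
  by rewrite lt_min d0 ltr01.
move=> b Ub; rewrite lt_min => /andP[hd h1]; apply: le_trans (h b Ub hd) _.
rewrite ler_wpM2l ?(ltW C0) //.
have := normr_ge0 (b - b0); rewrite le_eqVlt => /orP[/eqP <-|x0].
  by rewrite !powR0 ?gt_eqF // (lt_le_trans a'0).
by apply: ger_powR => //; rewrite x0 ltW.
Qed.

(** If the eigenvalue were too regular, every base b whose expansion of 1
    follows that of b0 for n digits would have a tail of digits whose series
    is small at w0; this fails for one of two bases whose tails differ by a
    single digit. *)
Lemma not_holder_le1 a : M%:R^-1 * (Lam / ln b0) < a -> a <= 1 ->
  ~ holder_at U lam b0 a.
Proof.
move=> ha a1 [C [d [C0 d0 hC]]].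
have lnb0 : 0 < ln b0 by rewrite ln_gt0.
have M0 : 0 < M%:R :> R by rewrite ltr0n.
have a0 : 0 < a by apply: lt_trans ha; case/andP: alpha0_itv.
have haM : Lam < a * M%:R * ln b0.
  by move: ha; rewrite mulrC ltr_pdivrMr // ltr_pdivrMr.
pose w0 := zero b0.
(* The exponent s lies strictly between ln (b0^(- a M)) and ln |w0|. *)
pose s := (- (a * M%:R * ln b0) - Lam) / 2.
pose r2 := expR s; pose rho := expR (- (a * M%:R * ln b0) - s).
pose rho2 := expR (- (a * ln b0)).
have r20 : 0 < r2 by exact: expR_gt0.
have r2w : r2 < normc w0 by rewrite normc_zero0 ltr_expR /s; lra.
have rho0 : 0 < rho by exact: expR_gt0.
have rho20 : 0 < rho2 by exact: expR_gt0.
have rho1 : rho < 1 by rewrite -expR0 ltr_expR /s; lra.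
have rho21 : rho2 < 1 by rewrite -expR0 ltr_expR oppr_lt0 mulr_gt0.
have w01 : normc w0 < 1 := zero_lt1 U_b0.
pose sg := (1 - normc w0) / 2; have sg0 : 0 < sg by rewrite divr_gt0 // subr_gt0.
have [C1 [d1 [C10 d10 hC1]]] := kneading_order0.
pose K := b0 * C + 1; have K0 : 0 < K by rewrite addr_gt0 // mulr_gt0.
pose e := Num.min (Num.min d d1) (Num.min sg (Num.min 1 (normc w0 - r2))).
have e0 : 0 < e by rewrite !lt_min d0 d10 sg0 ltr01 subr_gt0.
have [d' d'0 hd'] := zero_near e0.
pose A1 := sg^-1 * (C1 * K ^+ M) / r2 ^+ 2.
pose A2 := K * (sg^-1 * (sg^-1 * (b0 + b0))).
have A10 : 0 <= A1.
  by rewrite !mulr_ge0 ?invr_ge0 ?exprn_ge0 // ltW.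
have A20 : 0 <= A2.
  rewrite mulr_ge0 ?(ltW K0) // !mulr_ge0 ?invr_ge0 ?(ltW sg0) //.
  by rewrite addr_ge0 // ltW.
pose H (b : R) n := ps (fun j => cdigit b (n.+1 + j) - cqdigit b0 (n.+1 + j)).
have linfH b n : 1 <= b -> b < b0 ->
    linf_le (fun j => cdigit b (n.+1 + j) - cqdigit b0 (n.+1 + j)) (b0 + b0).
  move=> b1 bb; have b_0 : 0 < b by apply: lt_le_trans b1.
  have h := linf_leB (linf_le_drop n.+1 (cdigit_linf b_0))
    (linf_le_drop n.+1 (cqdigit_linf b0_pos)).
  by move=> j; apply: le_trans (h j) _; rewrite lerD2r ltW.
(* H b n is the tail of the digits of b relative to those of b0. At the zero z
   of b it is kneading at z divided by z^(n+2), hence at most of order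
   b0^(- a M n) / r2^n; the Lipschitz estimate then moves z to w0. *)
have small : exists N, forall n, (N <= n)%N -> forall b, 1 <= b -> b < b0 ->
    b0 ^+ n * (b0 - b) <= 1 ->
    (forall i, (i < n.+1)%N -> digit b i = qdigit b0 i) ->
    normc (H b n w0) < 1 / 2.
  have q4 : 0 < 1 / 4 :> R by rewrite divr_gt0.
  have [N1 hN1] := geometric_small rho0 rho1 A10 q4.
  have [N2 hN2] := geometric_small rho20 rho21 A20 q4.
  have b0V0 : 0 < b0^-1 by rewrite invr_gt0.
  have b0V1 : b0^-1 < 1 by rewrite invf_lt1.
  have [N3 hN3] := geometric_small b0V0 b0V1 ler01 d'0.
  exists (maxn N1 (maxn N2 N3)) => n; rewrite !geq_max.
  move=> /and3P[/hN1 hn1 /hN2 hn2 /hN3 hn3] b b_ge1 bb0 near agree.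
  have x0 : 0 < b0 - b by rewrite subr_gt0.
  have xE : `|b - b0| = b0 - b by rewrite distrC gtr0_norm.
  have bn0 : 0 < b0 ^+ n by rewrite exprn_gt0.
  have xn : b0 - b <= b0^-1 ^+ n.
    by rewrite exprVn -[leRHS]mul1r ler_pdivlMr // mulrC.
  have xd' : `|b - b0| < d' by rewrite xE; move: hn3; rewrite mul1r; lra.
  have [Ub] := hd' _ xd'; rewrite !lt_min xE.
  move=> /andP[/andP[xd xd1] _] /andP[/andP[_ zd1] /andP[zsg /andP[_ zr2]]].
  set z := zero b in zd1 zsg zr2.
  have xa : (b0 - b) `^ a <= rho2 ^+ n.
    have <- : (b0^-1 ^+ n) `^ a = rho2 ^+ n.
      rewrite -[b0]lnK ?posrE // -expRN /rho2 -!expRM_natl powR_expR.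
      by congr expR; ring.
    by apply: ge0_ler_powR; rewrite ?nnegrE ?exprn_ge0 ?invr_ge0 // ltW.
  have zK : normc (z - w0) <= K * rho2 ^+ n.
    have h1 := zero_gap Ub.
    have h2 := hC b Ub; rewrite xE in h1 h2; have {}h2 := h2 xd.
    have h3 : b0 - b <= (b0 - b) `^ a.
      apply: le_powR_self => //; try exact: ltW.
      apply: le_trans xn _; rewrite exprn_ile1 ?invr_ge0 ?(ltW b0_pos) //.
      exact: ltW.
    have h4 : b * normc (lam b - lam b0) <= b0 * (C * (b0 - b) `^ a).
      apply: ler_pM; rewrite ?normc_ge0 //; last exact: ltW.
      exact: le_trans ler01 b_ge1.
    have h5 : K * (b0 - b) `^ a <= K * rho2 ^+ n by rewrite ler_wpM2l // ltW.
    by apply: le_trans h5; rewrite /K; lra.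
  have z1 : normc z < 1 by case: (hC1 _ zd1).
  have z_sg : sg <= 1 - normc z.
    by have := normc_rtriangle z w0; rewrite /sg in zsg *; lra.
  have z_r2 : r2 <= normc z.
    by have := normc_rtriangle w0 z; rewrite (normc_distC w0); lra.
  have zinv : (1 - normc z)^-1 <= sg^-1.
    by rewrite lef_pV2 // posrE ?subr_gt0.
  have hQ : normc (qkneading b0 z) <= sg^-1 * (C1 * K ^+ M) * (rho2 ^+ n) ^+ M.
    have [th [E th1 _]] := kneading_qkneading b0_gt1 z1.
    have [_ hP _] := hC1 _ zd1; rewrite E normcM in hP.
    have h1 : sg * normc (qkneading b0 z) <= normc th * normc (qkneading b0 z).
      by rewrite ler_wpM2r ?normc_ge0 //; lra.
    rewrite -mulrA ler_pdivlMl //; apply: le_trans h1 (le_trans hP _).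
    rewrite -mulrA ler_wpM2l ?(ltW C10) // -exprMn.
    by rewrite lerXn2r ?nnegrE ?normc_ge0 // mulr_ge0 ?exprn_ge0 // ltW.
  have QH : qkneading b0 z = z ^+ n.+2 * H b n z.
    have := kneading_zero Ub; rewrite -/z /kneading => /eqP.
    rewrite subr_eq0 => /eqP E; rewrite /qkneading {1}E -mulrBr.
    have b_0 : 0 < b by apply: lt_le_trans b_ge1.
    rewrite (@ps_agree _ _ _ _ n.+1 z (cdigit_linf b_0) (cqdigit_linf b0_pos) z1).
      by rewrite mulrA -exprS.
    by move=> i i_n; rewrite /cdigit /cqdigit agree.
  have Hz : normc (H b n z) <= A1 * rho ^+ n.
    have rn0 : 0 < r2 ^+ n.+2 by rewrite exprn_gt0.
    have h1 : r2 ^+ n.+2 * normc (H b n z) <= normc (qkneading b0 z).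
      rewrite QH normcM normcX ler_wpM2r ?normc_ge0 //.
      by rewrite lerXn2r ?nnegrE ?normc_ge0 // ltW.
    rewrite -(ler_pM2l rn0); apply: le_trans h1 (le_trans hQ _).
    have -> : (rho2 ^+ n) ^+ M = rho ^+ n * r2 ^+ n.
      rewrite -exprM mulnC exprM -exprMn -expRD -expRM_natl; congr (expR _ ^+ n).
      by rewrite /s; field.
    rewrite le_eqVlt; apply/orP; left; apply/eqP; rewrite /A1 -addn2 exprD.
    have : r2 ^+ 2 != 0 by rewrite expf_neq0 // gt_eqF.
    by move: (r2 ^+ 2) (r2 ^+ n) (rho ^+ n) (sg^-1 * _) => W Z Y X W0; field.
  have lip := ps_lipschitz w01 z1 (linfH b n b_ge1 bb0).
  have lip' : normc (H b n z - H b n w0) <= A2 * rho2 ^+ n.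
    apply: le_trans lip _; rewrite /A2 mulrAC; apply: ler_pM.
    - exact: normc_ge0.
    - by rewrite !mulr_ge0 ?invr_ge0 ?subr_ge0 ?addr_ge0 // ltW.
    - exact: zK.
    - apply: ler_pM; rewrite ?invr_ge0 ?subr_ge0 ?(ltW z1) //.
        by rewrite mulr_ge0 ?invr_ge0 ?subr_ge0 ?addr_ge0 // ltW.
      apply: ler_wpM2r; first by rewrite addr_ge0 // ltW.
      rewrite lef_pV2 ?posrE ?subr_gt0 // /sg.
      by have := normc_ge0 w0; lra.
  have h := normc_rtriangle (H b n w0) (H b n z).
  rewrite (normc_distC (H b n w0)) in h.
  have -> : 1 / 2 = 1 / 4 + 1 / 4 :> R by field.
  apply: le_lt_trans h _; apply: le_lt_trans (lerD Hz lip') _.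
  exact: ltrD hn1 hn2.
have [N hN] := small.
have [[//|n] Nn hq] := @qorbit_large R b0 N.+1 b0_gt1.
have [x [y [[xb x1 nx] [yb y1 ny] agree tails]]] := finite_expansions b0_gt1 hq.
have hx := hN n Nn x x1 xb nx (fun i i_n => (agree i i_n).1).
have hy := hN n Nn y y1 yb ny (fun i i_n => (agree i i_n).2).
have E : H y n w0 - H x n w0 = 1.
  rewrite -(psB (linfH y n y1 yb) (linfH x n x1 xb) w01).
  rewrite (@ps_finite _ _ _ 1).
    rewrite big_ord1 mul1r opprB addrA subrK /cdigit.
    by rewrite (tails 0%N).1 (tails 0%N).2 subr0.
  case=> [//|j] _; rewrite opprB addrA subrK /cdigit.
  by rewrite (tails j.+1).1 (tails j.+1).2 subrr.
have := normcB_le (H y n w0) (H x n w0); rewrite E normc1; lra.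
Qed.

Lemma not_holder a : M%:R^-1 * (Lam / ln b0) < a -> ~ holder_at U lam b0 a.
Proof.
move=> ha hh; have /andP[al0 al1] := alpha0_itv.
have ha' : M%:R^-1 * (Lam / ln b0) < Num.min a 1 by rewrite lt_min ha al1.
apply: (not_holder_le1 ha'); first by rewrite ge_min lexx orbT.
apply: holder_at_weaken hh; last by rewrite ge_min lexx.
exact: lt_trans al0 ha'.
Qed.

(** Differentiability would give the exponent 1, which exceeds alpha0. *)
Lemma not_differentiable : ~ cdifferentiable_at lam b0.
Proof.
move=> /cvg_ex[/= l hl]; have /andP[_ al1] := alpha0_itv.
apply: (not_holder al1).
have /cvgrPdist_lt /(_ 1 ltr01) /nbhs_ballP[d /= d0 hd] := hl.
exists (normc (l : R[i]) + 1), d; split=> //.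
  by rewrite ltr_wpDl ?normc_ge0.
move=> b _ hb; rewrite powRr1 ?normr_ge0 //.
have [->|bb] := eqVneq b b0; first by rewrite !subrr normc0 normr0 mulr0.
have h0 : b - b0 != 0 by rewrite subr_eq0.
have : ball (0 : R) d (b - b0) by rewrite /ball /= sub0r normrN.
move=> /hd /(_ h0) /=; rewrite subrKC.
set q := (lam b - lam b0) / _ => hq.
have {}hq : normc ((l : R[i]) - q) < 1.
  by move: hq; rewrite -[`|_|]/((normc (l - q))%:C) ltcR.
have -> : lam b - lam b0 = q * (b - b0)%:C.
  by rewrite /q divfK // -normc_gt0 normc_real normr_gt0.
rewrite normcM normc_real ler_wpM2r //.
have := normc_rtriangle q (l : R[i]); rewrite (normc_distC q); lra.
Qed.

End Perturbation.

Unset Implicit Arguments.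

Theorem theorem3p1 (R : realType) (b0 : R) (M : nat)
    (U : set R) (V : set R[i]^o) (lam : R -> R[i]^o)
    (b0_gt1 : 1 < b0) (b0_nint : b0 \isn't a Num.int)
    (M_ge1 : (1 <= M)%N)
    (lam0_eig : nonleading_eigenvalue b0 (lam b0))
    (lam0_mult : eigenvalue_multiplicity b0 (lam b0) M)
    (U_open : open U) (U_b0 : U b0) (U_gt1 : forall b, U b -> 1 < b)
    (V_open : open V) (V_lam0 : V (lam b0))
    (lam_V : forall b, U b -> V (lam b))
    (lam_cont : {for b0, continuous lam})
    (lam_eig : forall b, U b -> nonleading_eigenvalue b (lam b)) :
  [/\ 0 < gamma1 b0 ->
      let alpha1 := M%:R^-1 *
        (ln (normc (b0%:C * lam b0)) / (ln b0 + ln (gamma1 b0)^-1)) in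
      forall a : R, 0 < a -> a < alpha1 ->
        holder_at (U `&` [set b | b < b0]) lam b0 a,
      0 < gamma2 b0 ->
      let alpha2 := M%:R^-1 *
        (ln (normc (b0%:C * lam b0)) / (ln b0 + ln (gamma2 b0)^-1)) in
      forall a : R, 0 < a -> a < alpha2 ->
        holder_at (U `&` [set b | b0 < b]) lam b0 a
    & let alpha0 := M%:R^-1 * (ln (normc (b0%:C * lam b0)) / ln b0) in
      (forall a : R, alpha0 < a -> ~ holder_at U lam b0 a) /\
      ~ cdifferentiable_at lam b0].
Proof.
have b00 : 0 < b0 by apply: lt_trans b0_gt1.
split.
- have q_itv n : 0 <= qorbit b0 n <= 1.
    by have /andP[/ltW -> ->] := qorbit_itv b0 n.
  have E : gamma1 b0 = limn_inf (fun n => qorbit b0 n `^ (n%:R^-1)).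
    by rewrite /gamma1; congr limn_inf; apply/funext => n; rewrite lim_iter_tau.
  move=> g0 /= a a0 ha.
  apply: (holder_of_digits (u := qorbit b0) b0_gt1 M_ge1 lam0_mult U_open U_b0 U_gt1 lam_cont
    lam_eig (cqdigit_linf b00) _ g0 _ _ _ a0 ha).
  + move=> w w1; have [th [-> _ th2]] := kneading_qkneading b0_gt1 w1.
    by rewrite normcM ler_wpM2r ?normc_ge0.
  + by rewrite E; exact: limn_inf_root_le1.
  + move=> g gpos; rewrite E => hg; apply: (@limn_inf_root_gt R _ q_itv g _ gpos hg).
    by move=> n; case/andP: (qorbit_itv b0 n.+1).
  + move=> b /= bb b1; have [n [h1 h2]] := first_diff_left b1 bb.
    exists n; split=> [i i_n|]; first by rewrite /cdigit /cqdigit h1.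
    by rewrite (max_r (ltW bb)) distrC gtr0_norm ?subr_gt0.
- pose u n := 1 - orbit1 b0 n.
  have u_itv n : 0 <= u n <= 1.
    by have /andP[h1 h2] := orbit1_itv b0 n; rewrite /u; apply/andP; split; lra.
  move=> g0 /= a a0 ha.
  apply: (holder_of_digits (u := u) b0_gt1 M_ge1 lam0_mult U_open U_b0 U_gt1 lam_cont
    lam_eig (cdigit_linf b00) _ g0 _ _ _ a0 ha).
  + by move=> w w1; rewrite ler_peMl ?normc_ge0 // ler1n.
  + exact: (@limn_inf_root_le1 R u u_itv).
  + move=> g gpos hg; apply: (@limn_inf_root_gt R u u_itv g _ gpos hg).
    by move=> n; rewrite subr_gt0 orbit1_lt1.
  + move=> b /= bb b1; have [n [h1 h2]] := first_diff_right b0_gt1 bb.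
    exists n; split=> [i i_n|]; first by rewrite /cdigit h1.
    rewrite (max_l (ltW bb)) gtr0_norm ?subr_gt0 //; apply: le_trans h2 _.
    rewrite ler_wpM2l ?subr_ge0 ?(ltW bb) // ler_wpM2l ?exprn_ge0 ?(ltW (lt_trans b00 bb)) //.
    by rewrite lef_pV2 ?posrE ?subr_gt0 // lerD2r ltW.
- split=> [a ha|].
    exact: (not_holder b0_gt1 M_ge1 lam0_mult U_open U_b0 U_gt1 lam_cont lam_eig ha).
  exact: (not_differentiable b0_gt1 M_ge1 lam0_mult U_open U_b0 U_gt1 lam_cont lam_eig).
Qed.
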